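(* Let $N\ge 2$, and let $u_0,u_1,\dots,u_N$ be scalar functions of the variables $x^1,\dots,x^N,t^1_1,\dots,t^N_1$ such that the vector fields $$X_k=\partial^k_1-\lambda\,\partial_k+(\partial_k\hat u)+(\partial_k u_0)\,\partial_\lambda,\qquad 1\le k\le N,$$ commute pairwise. Let $\gamma$ be a closed curve in the complex $\lambda$-plane (for example the unit circle), and let $\Psi(\mathbf{t},\lambda)$ be a wave function defined on $\gamma$, i.e. a scalar function satisfying $X_k\Psi=0$ for all $1\le k\le N$. Then the function $$\phi_1(\mathbf{t})=-\frac{1}{2\pi i}\oint_\gamma \Psi(\mathbf{t},\mu)\,d\mu$$ satisfies, for all $1\le k,q\le N$, the linear equations $$\Big(\big(\partial^k_1+(\partial_k\hat u)\big)\partial_q-\big(\partial^q_1+(\partial_q\hat u)\big)\partial_k\Big)\phi_1=0.$$ In particular, if $\Psi^0,\dots,\Psi^N$ are wave functions defined on $\gamma$ and $r$ is an arbitrary complex analytic function of $N+1$ variables, then $$\phi_1=-\frac{1}{2\pi i}\oint_\gamma r(\Psi^0,\dots,\Psi^N)\,d\mu$$ is a solution of these equations.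
   Context: Notation: $\mathbf{t}=(x^1,\dots,x^N,t^1_1,\dots,t^N_1)$, $\partial_k=\partial/\partial x^k$, $\partial^k_1=\partial/\partial t^k_1$, $\partial_\lambda=\partial/\partial\lambda$. Further, $\hat u=\sum_{p=1}^N u_p\,\partial_p$ is a vector field (with no $\partial_\lambda$ component), and $(\partial_k\hat u)=\sum_{p=1}^N(\partial_k u_p)\,\partial_p$ denotes the vector field obtained by differentiating its coefficients; $(\partial_k\hat u)\partial_q$ is the second-order operator $f\mapsto\sum_p(\partial_k u_p)\,\partial_p\partial_q f$. The functions $u_0,\dots,u_N$ do not depend on $\lambda$. Pairwise commutativity of the $X_k$ means that $(u_0,\hat u)$ solves the dispersionless system $$\partial^k_1\partial_q\hat u-\partial^q_1\partial_k\hat u+[\partial_k\hat u,\partial_q\hat u]=(\partial_k u_0)\partial_q-(\partial_q u_0)\partial_k,$$ $$\partial^k_1\partial_q u_0-\partial^q_1\partial_k u_0+(\partial_k\hat u)\partial_q u_0-(\partial_q\hat u)\partial_k u_0=0.$$ Regularity conventions: the $u_i$ are smooth (or complex analytic) in $\mathbf{t}$; ''a wave function defined on $\gamma$'' means a function $\Psi(\mathbf{t},\lambda)$, smooth jointly in its variables and holomorphic in $\lambda$ in a neighbourhood of $\gamma$, satisfying $X_k\Psi=0$ for all $k$ there. The analytic function $r$ is assumed defined on an open set containing the values of $(\Psi^0,\dots,\Psi^N)$ for $\lambda$ in a neighbourhood of $\gamma$. *)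

(* Defs.v *)
From Stdlib Require Import Reals.
From Coquelicot Require Import Coquelicot.
From mathcomp Require Import all_boot.
Set Implicit Arguments.
Unset Strict Implicit.
Unset Printing Implicit Defensive.
Local Open Scope R_scope.

(** Analysis is Coquelicot over the Stdlib reals; mathcomp only supplies the
    finite index types and [\big]. *)

(** The independent variables t are either real, with smooth coefficients, or
    complex, with complex analytic coefficients.  All functions are
    complex valued in both cases. *)
Inductive scalars := RealVars | ComplexVars.

Definition K (c : scalars) : UniformSpace :=
  match c with RealVars => R_UniformSpace | ComplexVars => C_UniformSpace end.

Definition is_deriv (c : scalars) : (K c -> C) -> K c -> C -> Prop :=
  match c with
  | RealVars => fun f x l => @is_derive R_AbsRing C_R_NormedModule f x l
  | ComplexVars => fun f z l => @is_derive C_AbsRing C_NormedModule f z l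
  end.

(** Total version: equal to l whenever [is_deriv c f x l]. *)
Definition deriv (c : scalars) : (K c -> C) -> K c -> C :=
  match c with
  | RealVars => fun f x => (Derive (fun s => Re (f s)) x, Derive (fun s => Im (f s)) x)
  | ComplexVars => fun f z => C_derive f z
  end.

(** K^I; as I is finite, the uniform structure of [fct_UniformSpace] is that of
    the sup norm. *)
Definition pts (c : scalars) (I : finType) : UniformSpace :=
  fct_UniformSpace I (K c).

Definition upd (I : finType) (A : Type) (p : I -> A) (i : I) (s : A) : I -> A :=
  fun j => if j == i then s else p j.

Definition is_pd (c : scalars) (I : finType) (i : I) (f : pts c I -> C)
    (p : pts c I) (l : C) : Prop :=
  is_deriv (fun s : K c => f (upd p i s)) (p i) l.

Definition pd (c : scalars) (I : finType) (i : I) (f : pts c I -> C) : pts c I -> C :=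
  fun p => deriv (fun s : K c => f (upd p i s)) (p i).

(** f has all iterated derivatives of order at most n with respect to the
    partial differentiations [op j], and they are continuous at the points of D;
    D is always open below. *)
Fixpoint Ck (T : UniformSpace) (J : Type) (op : J -> (T -> C) -> T -> C -> Prop)
    (n : nat) (D : T -> Prop) (f : T -> C) {struct n} : Prop :=
  (forall p, D p -> continuous f p) /\
  match n with
  | O => True
  | S m => forall j, exists g : T -> C,
      (forall p, D p -> op j f p (g p)) /\ Ck op m D g
  end.

(** C^oo for real variables.  For complex variables, continuity of f and of its
    first order complex partial derivatives, i.e. f is complex analytic. *)
Definition regular_for (c : scalars) (T : UniformSpace) (J : Type)
    (op : J -> (T -> C) -> T -> C -> Prop) (D : T -> Prop) (f : T -> C) : Prop :=
  match c with
  | RealVars => forall n, Ck op n D f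
  | ComplexVars => Ck op 1 D f
  end.

Definition regular (c : scalars) (I : finType) (D : pts c I -> Prop)
    (f : pts c I -> C) : Prop :=
  regular_for c (@is_pd c I) D f.

Definition analytic (I : finType) (D : pts ComplexVars I -> Prop)
    (f : pts ComplexVars I -> C) : Prop := regular D f.

(** * Functions of (t, lambda) *)

Definition jpts (c : scalars) (I : finType) : UniformSpace :=
  prod_UniformSpace (pts c I) C_UniformSpace.

(** Directions: a coordinate of t, or Re lambda ([false]), or Im lambda ([true]). *)
Definition is_jpd (c : scalars) (I : finType) (d : I + bool) (F : jpts c I -> C)
    (p : jpts c I) (l : C) : Prop :=
  match d with
  | inl i => is_pd i (fun t => F (t, p.2)) p.1 l
  | inr false => @is_derive R_AbsRing C_R_NormedModule
                   (fun s : R => F (p.1, (s, Im p.2))) (Re p.2) l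
  | inr true => @is_derive R_AbsRing C_R_NormedModule
                   (fun s : R => F (p.1, (Re p.2, s))) (Im p.2) l
  end.

Definition regular_hol (c : scalars) (I : finType) (D : jpts c I -> Prop)
    (F : jpts c I -> C) : Prop :=
  regular_for c (@is_jpd c I) D F /\
  forall p : jpts c I, D p ->
    exists l : C, @is_derive C_AbsRing C_NormedModule (fun z : C => F (p.1, z)) p.2 l.

Definition pdt (c : scalars) (I : finType) (i : I) (F : jpts c I -> C) : jpts c I -> C :=
  fun p => pd i (fun t => F (t, p.2)) p.1.

Definition pdlam (c : scalars) (I : finType) (F : jpts c I -> C) : jpts c I -> C :=
  fun p => C_derive (fun z : C => F (p.1, z)) p.2.

(** * The vector fields X_k *)

(** t = (x^1, ..., x^N, t^1_1, ..., t^N_1): [inl k] is the coordinate x^k and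
    [inr k] the coordinate t^k_1. *)
Definition coords (N : nat) : finType := ('I_N + 'I_N)%type.

Definition dx (N : nat) (k : 'I_N) : coords N := inl k.
Definition dt (N : nat) (k : 'I_N) : coords N := inr k.

Definition Csum (N : nat) (f : 'I_N -> C) : C := \big[Cplus/RtoC 0]_(p < N) f p.

(** The argument [u] lists u_1, ..., u_N. *)
Definition X (c : scalars) (N : nat) (u0 : pts c (coords N) -> C)
    (u : 'I_N -> pts c (coords N) -> C) (k : 'I_N)
    (F : jpts c (coords N) -> C) : jpts c (coords N) -> C :=
  fun P =>
    (pdt (dt k) F P - P.2 * pdt (dx k) F P
     + Csum (fun p => pd (dx k) (u p) P.1 * pdt (dx p) F P)
     + pd (dx k) u0 P.1 * pdlam F P)%C.

(** [X_k, X_q] = 0 as operators on functions of (t, lambda), t in U, holomorphic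
    in lambda. *)
Definition commute_pairwise (c : scalars) (N : nat) (U : pts c (coords N) -> Prop)
    (u0 : pts c (coords N) -> C) (u : 'I_N -> pts c (coords N) -> C) : Prop :=
  forall (k q : 'I_N) (F : jpts c (coords N) -> C),
    regular_hol (fun P => U P.1) F ->
    forall P : jpts c (coords N), U P.1 ->
      X u0 u k (X u0 u q F) P = X u0 u q (X u0 u k F) P.

(** * Curves *)

Definition C1_curve (g : R -> C) : Prop :=
  exists g' : R -> C, forall s : R,
    @is_derive R_AbsRing C_R_NormedModule g s (g' s) /\ continuous g' s.

(** On each piece the curve extends to a C^1 function on R, which amounts to
    being C^1 up to the end points of the piece. *)
Definition piecewise_C1 (a b : R) (gam : R -> C) : Prop :=
  exists (n : nat) (sg : nat -> R),
    sg 0%N = a /\ sg n = b /\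
    forall i, (i < n)%N ->
      sg i < sg i.+1 /\
      exists g : R -> C, C1_curve g /\
        forall s, sg i <= s <= sg i.+1 -> gam s = g s.

Definition closed_curve (a b : R) (gam : R -> C) : Prop :=
  a < b /\ piecewise_C1 a b gam /\ gam a = gam b.

Definition contour_int (a b : R) (gam : R -> C) (f : C -> C) : C :=
  @RInt C_R_CompleteNormedModule
    (fun s : R => Cmult (f (gam s)) (@deriv RealVars gam s)) a b.

Definition nbhd_of_curve (a b : R) (gam : R -> C) (V : C -> Prop) : Prop :=
  open V /\ forall s, a <= s <= b -> V (gam s).

(** * Wave functions and the linear equations *)

Definition wave_function (c : scalars) (N : nat) (U : pts c (coords N) -> Prop)
    (u0 : pts c (coords N) -> C) (u : 'I_N -> pts c (coords N) -> C)
    (a b : R) (gam : R -> C) (Psi : jpts c (coords N) -> C) : Prop :=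
  exists V : C -> Prop,
    nbhd_of_curve a b gam V /\
    regular_hol (fun P => U P.1 /\ V P.2) Psi /\
    forall (k : 'I_N) (P : jpts c (coords N)),
      U P.1 -> V P.2 -> X u0 u k Psi P = RtoC 0.

Definition phi1 (c : scalars) (N : nat) (a b : R) (gam : R -> C)
    (Psi : jpts c (coords N) -> C) : pts c (coords N) -> C :=
  fun t => (- (RtoC 1 / (RtoC 2 * RtoC PI * Ci))
              * contour_int a b gam (fun mu => Psi (t, mu)))%C.

(** (d^k_1 + (d_k u^)) f *)
Definition Dt (c : scalars) (N : nat) (u : 'I_N -> pts c (coords N) -> C) (k : 'I_N)
    (f : pts c (coords N) -> C) : pts c (coords N) -> C :=
  fun t => (pd (dt k) f t + Csum (fun p => pd (dx k) (u p) t * pd (dx p) f t))%C.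

(** [pd] is total, so the existence of the derivatives of f of order at most 2
    is part of being a solution. *)
Definition solves_linear (c : scalars) (N : nat) (U : pts c (coords N) -> Prop)
    (u : 'I_N -> pts c (coords N) -> C) (f : pts c (coords N) -> C) : Prop :=
  Ck (@is_pd c (coords N)) 2 U f /\
  forall (k q : 'I_N) (t : pts c (coords N)), U t ->
    (Dt u k (pd (dx q) f) t - Dt u q (pd (dx k) f) t)%C = RtoC 0.

(* Main.v *)
Require Import Defs.
From HB Require Import structures.
From Stdlib Require Import Reals Lra FunctionalExtensionality ClassicalEpsilon Classical.
From Coquelicot Require Import Coquelicot.
From mathcomp Require Import all_boot.

(** Put D_k = d^k_1 + (d_k u^), A = oint Psi and B = oint lambda Psi.  Since the
    contour is closed, oint d_lambda Psi = 0, so integrating X_k Psi = 0 over it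
    gives D_k A = d_k B.  As [D_k, d_q] = - (d_q d_k u^) is symmetric in k and q,
    (D_k d_q - D_q d_k) A = d_q D_k A - d_k D_q A = d_q d_k B - d_k d_q B = 0.
    In the complex case the second derivatives exist by Cauchy's formula.  A
    function r of wave functions is a wave function because the X_k are
    derivations. *)

Set Implicit Arguments.
Unset Strict Implicit.
Unset Printing Implicit Defensive.
Local Open Scope R_scope.

(** Real and complex variables share one calculus: [emb] reads an increment of [K c] as a complex
    number, so both notions of derivative become the same estimate in [Cmod]. The mean value theorem
    fails for complex-valued functions; its substitute is a bound on the deviation from a fixed
    slope. That bound yields differentiation under the integral, the symmetry of second derivatives
    and the chain rule in several variables. For complex variables [regular] grants only continuous
    first partials, while the commutator argument differentiates twice. Continuity of these partials
    opens an elementary way to Cauchy's formula: the circle is contracted to the point, and the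
    integral is differentiated in the contraction parameter. On the given contour no such formula
    enters: [Psi] is itself the primitive of its lambda-derivative. The curve may have corners, so
    its integrals are rewritten as sums over C^1 pieces before a parameter is varied. *)

Definition emb (c : scalars) : K c -> C :=
  match c with RealVars => RtoC | ComplexVars => fun z => z end.
Arguments emb {c} _.

Lemma emb_inj c (x y : K c) : emb x = emb y -> x = y.
Proof. by case: c x y => x y //= -[]. Qed.

(** Supplies in both cases a point at a prescribed real displacement. Uniqueness of derivatives and
    symmetry of second derivatives divide by such an increment. *)
Lemma emb_shift c (x : K c) (t : R) : exists y : K c, (emb y - emb x = RtoC t)%C.
Proof.
case: c x => x /=.
  by exists (x + t); rewrite RtoC_plus; ring.
by exists (x + RtoC t)%C; ring.
Qed.


(** * Moduli, balls and continuity in epsilon-delta form *)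

Lemma Cmod_le_abs (z : C) : Cmod z <= Rabs (Re z) + Rabs (Im z).
Proof.
have -> : z = (RtoC (Re z) + Ci * RtoC (Im z))%C.
  by case: z => a b; rewrite /Ci /RtoC /Cplus /Cmult /=; congr pair; ring.
apply: Rle_trans (Cmod_triangle _ _) _.
rewrite Cmod_mult Cmod_Ci !Cmod_R.
have -> : Re (Re z + Ci * Im z) = Re z by rewrite /Re /=; ring.
have -> : Im (Re z + Ci * Im z) = Im z by rewrite /Im /=; ring.
lra.
Qed.

Lemma im_le_Cmod (z : C) : Rabs (Im z) <= Cmod z.
Proof. exact: Rle_trans (Rmax_r _ _) (Rmax_Cmod z). Qed.

Lemma Cmod_minus_sym (x y : C) : Cmod (x - y) = Cmod (y - x).
Proof. by rewrite -Cmod_opp; congr Cmod; ring. Qed.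

Lemma Cmod_minus_triangle (x y z : C) : Cmod (x - z) <= Cmod (x - y) + Cmod (y - z).
Proof. by have -> : (x - z = (x - y) + (y - z))%C by [ring]; apply: Cmod_triangle. Qed.

Lemma ball_emb c (x y : K c) (d : R) : Cmod (emb y - emb x) < d -> ball x d y.
Proof.
case: c x y => x y /= H.
  move: H; rewrite -RtoC_minus Cmod_R; exact.
split.
  apply: Rle_lt_trans H; exact: (re_le_Cmod (y - x)%C).
apply: Rle_lt_trans H; exact: (im_le_Cmod (y - x)%C).
Qed.

(** Balls of [C_UniformSpace] are squares in Re and Im, not disks; the factor 2 comes from |z| <=
    |Re z| + |Im z|. *)
Lemma emb_ball c (x y : K c) (d : R) : ball x d y -> Cmod (emb y - emb x) < 2 * d.
Proof.
case: c x y => x y /= H.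
  rewrite -RtoC_minus Cmod_R.
  have : Rabs (y - x) < d by exact: H.
  have := Rabs_pos (y - x); lra.
case: H => H1 H2.
have H1' : Rabs (Re (y - x)) < d by exact: H1.
have H2' : Rabs (Im (y - x)) < d by exact: H2.
have := Cmod_le_abs (y - x)%C; lra.
Qed.

Lemma locallyP (T : UniformSpace) (p : T) (P : T -> Prop) :
  locally p P <-> exists d : R, 0 < d /\ forall q, ball p d q -> P q.
Proof.
split; first by case=> d H; exists d; split=> //; apply: cond_pos.
by case=> d [d0 H]; exists (mkposreal d d0).
Qed.

Lemma continuousP (T : UniformSpace) (f : T -> C) (p : T) :
  continuous f p <->
  forall e, 0 < e -> exists d : R, 0 < d /\ forall q, ball p d q -> Cmod (f q - f p) < e.
Proof.
split.
  move=> H e e0.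
  have e2 : 0 < e / 2 by lra.
  have /H /locallyP[d [d0 Hd]] : locally (f p) (ball (f p) (e / 2)) by exists (mkposreal _ e2).
  exists d; split=> // q /Hd Hq.
  have := @emb_ball ComplexVars _ _ _ Hq; rewrite /=; lra.
move=> H P [e He].
have [d [d0 Hd]] := H _ (cond_pos e).
apply/locallyP; exists d; split=> // q /Hd Hq.
by apply: He; apply: (@ball_emb ComplexVars).
Qed.

(** * Differentiation uniformly in the scalars *)

(** A real increment acts on C as multiplication by its embedding, so both derivatives unfold to one
    formula. The rules of calculus below rest on it and need no case split. *)
Lemma is_derivP c (f : K c -> C) (x : K c) (l : C) :
  is_deriv f x l <->
  forall e, 0 < e -> exists d, 0 < d /\ forall y : K c, Cmod (emb y - emb x) < d ->
    Cmod (f y - f x - (emb y - emb x) * l) <= e * Cmod (emb y - emb x).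
Proof.
case: c f x => f x /=.
- split.
    case=> _ /(_ x (fun P H => H)) H e e0.
    have [d Hd] := H (mkposreal e e0).
    exists d; split; first exact: cond_pos.
    move=> y Hy.
    have := Hd y; rewrite -RtoC_minus Cmod_R in Hy *.
    move=> /(_ Hy); rewrite -!Cmod_norm => Hn.
    apply: Rle_trans (Hn).
    right; congr Cmod.
    by rewrite /minus /plus /opp /scal /= /prod_plus /prod_opp /prod_scal /plus /opp /scal /= /mult /= /Cplus /Cmult /Copp /Cminus /= /Cplus /Copp /=; congr pair; ring.
  move=> H; split; first exact: is_linear_scal_l.
  move=> x' Hx'.
  (* The differential is quantified over all limit points of the filter at [x]; separation leaves
     only [x]. *)
  have -> : x' = x by apply/esym; apply: (is_filter_lim_locally_unique x x' Hx').
  move=> e.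
  have [d [d0 Hd]] := H e (cond_pos e).
  exists (mkposreal d d0) => y Hy.
  have := Hd y; rewrite -RtoC_minus Cmod_R => /(_ Hy).
  rewrite -!Cmod_norm => Hn.
  apply: Rle_trans (Hn).
  right; congr Cmod.
  by rewrite /minus /plus /opp /scal /= /prod_plus /prod_opp /prod_scal /plus /opp /scal /= /mult /= /Cplus /Cmult /Copp /Cminus /= /Cplus /Copp /=; congr pair; ring.
- split.
    case=> _ /(_ x (fun P H => H)) H e e0.
    have [d Hd] := H (mkposreal e e0).
    exists d; split; first exact: cond_pos.
    exact: Hd.
  move=> H; split; first exact: is_linear_scal_l.
  move=> x' Hx'.
  have -> : x' = x by apply/esym; apply: (@is_filter_lim_locally_unique C_AbsRing (AbsRing_NormedModule C_AbsRing) x x' Hx').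
  move=> e.
  have [d [d0 Hd]] := H e (cond_pos e).
  by exists (mkposreal d d0) => y Hy; apply: Hd.
Qed.

Lemma Cminus_eq_0 (x y : C) : (x - y)%C = RtoC 0 -> x = y.
Proof. by move=> H; apply/Ceq_minus. Qed.

Lemma continuous_Ceq (T : UniformSpace) (f g : T -> C) (p : T) :
  (forall q, f q = g q) -> continuous f p -> continuous g p.
Proof. by move=> H; apply: continuous_ext. Qed.

Lemma Cmod_bound_locally (T : UniformSpace) (f : T -> C) (p : T) :
  continuous f p -> exists d : R, 0 < d /\ forall q, ball p d q -> Cmod (f q) <= Cmod (f p) + 1.
Proof.
move/continuousP/(_ 1 Rlt_0_1) => [d [d0 H]].
exists d; split=> // q /H Hq.
have := Cmod_triangle (f q - f p)%C (f p).
have -> : (f q - f p + f p = f q)%C by ring.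
lra.
Qed.

Lemma continuous_Cplus (T : UniformSpace) (f g : T -> C) (p : T) :
  continuous f p -> continuous g p -> continuous (fun q => f q + g q)%C p.
Proof.
move=> /continuousP Hf /continuousP Hg; apply/continuousP=> e e0.
have e2 : 0 < e / 2 by lra.
have [d1 [d10 H1]] := Hf _ e2; have [d2 [d20 H2]] := Hg _ e2.
exists (Rmin d1 d2); split; first exact: Rmin_pos.
move=> q Hq.
have := H1 q (ball_le _ _ _ (Rmin_l _ _) _ Hq).
have := H2 q (ball_le _ _ _ (Rmin_r _ _) _ Hq).
have := Cmod_triangle (f q - f p)%C (g q - g p)%C.
have -> : (f q - f p + (g q - g p) = f q + g q - (f p + g p))%C by ring.
lra.
Qed.

Lemma continuous_Cmult (T : UniformSpace) (f g : T -> C) (p : T) :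
  continuous f p -> continuous g p -> continuous (fun q => f q * g q)%C p.
Proof.
move=> /continuousP Hf Hg'; have /continuousP Hg := Hg'; apply/continuousP=> e e0.
have [d0 [d00 H0]] := Cmod_bound_locally Hg'.
set M := (Cmod (g p) + 1) in H0.
set L := (Cmod (f p) + 1).
have M0 : 0 < M by rewrite /M; have := Cmod_ge_0 (g p); lra.
have L0 : 0 < L by rewrite /L; have := Cmod_ge_0 (f p); lra.
have [d1 [d10 H1]] := Hf (e / (2 * M)) (Rdiv_lt_0_compat e (2 * M) e0 ltac:(lra)).
have [d2 [d20 H2]] := Hg (e / (2 * L)) (Rdiv_lt_0_compat e (2 * L) e0 ltac:(lra)).
exists (Rmin d0 (Rmin d1 d2)); split; first by do! apply: Rmin_pos.
move=> q Hq.
have := H0 q (ball_le _ _ _ (Rmin_l _ _) _ Hq).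
have {}Hq := ball_le _ _ _ (Rmin_r _ _) _ Hq.
have := H1 q (ball_le _ _ _ (Rmin_l _ _) _ Hq).
have := H2 q (ball_le _ _ _ (Rmin_r _ _) _ Hq).
have -> : (f q * g q - f p * g p = (f q - f p) * g q + f p * (g q - g p))%C by ring.
move=> h2 h1 h0.
apply: Rle_lt_trans (Cmod_triangle _ _) _.
rewrite !Cmod_mult.
have : Cmod (f q - f p)%C * Cmod (g q) <= e / (2 * M) * M.
  apply: Rmult_le_compat; try exact: Cmod_ge_0; [lra|exact: h0].
have -> : e / (2 * M) * M = e / 2 by field; lra.
have : Cmod (f p) * Cmod (g q - g p)%C < L * (e / (2 * L)).
  apply: (Rle_lt_trans _ (L * Cmod (g q - g p)%C)).
    apply: Rmult_le_compat_r; [exact: Cmod_ge_0|rewrite /L; lra].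
  exact: Rmult_lt_compat_l.
have -> : L * (e / (2 * L)) = e / 2 by field; lra.
lra.
Qed.

Lemma continuous_Cconst (T : UniformSpace) (a : C) (p : T) : continuous (fun _ : T => a) p.
Proof. exact: continuous_const. Qed.

Lemma continuous_Cminus (T : UniformSpace) (f g : T -> C) (p : T) :
  continuous f p -> continuous g p -> continuous (fun q => f q - g q)%C p.
Proof.
move=> Hf Hg.
apply: (continuous_Ceq (f := (fun q => f q + (- RtoC 1) * g q)%C)).
  by move=> q; ring.
by apply: continuous_Cplus => //; apply: continuous_Cmult => //; apply: continuous_Cconst.
Qed.

Lemma continuous_Cinv (T : UniformSpace) (f : T -> C) (p : T) :
  continuous f p -> f p <> RtoC 0 -> continuous (fun q => / f q)%C p.
Proof.
move=> /continuousP Hf Hn; apply/continuousP=> e e0.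
have m0 := proj1 (Cmod_gt_0 _) Hn.
set m := Cmod (f p) in m0.
(* Near [p] one has |f q| > m / 2, so a numerator below e m^2 / 2 over m |f q| stays below e. *)
have e1 : 0 < e * (m * m) / 2.
  by apply: Rdiv_lt_0_compat; [do! apply: Rmult_lt_0_compat|lra].
have [d1 [d10 H1]] := Hf (m / 2) ltac:(lra); have [d2 [d20 H2]] := Hf _ e1.
exists (Rmin d1 d2); split; first exact: Rmin_pos.
move=> q Hq.
have h1 := H1 q (ball_le _ _ _ (Rmin_l _ _) _ Hq).
have h2 := H2 q (ball_le _ _ _ (Rmin_r _ _) _ Hq).
have hm : m / 2 < Cmod (f q).
  have := Cmod_triangle (f p - f q)%C (f q).
  have -> : (f p - f q + f q = f p)%C by ring.
  rewrite Cmod_minus_sym -/m; lra.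
have Hq0 : f q <> RtoC 0 by apply/Cmod_gt_0; lra.
have -> : (/ f q - / f p = (f p - f q) / (f p * f q))%C by field.
rewrite Cmod_div; last by apply: Cmult_neq_0.
rewrite Cmod_mult Cmod_minus_sym -/m.
apply: (Rlt_le_trans _ (e * (m * m) / 2 / (m * Cmod (f q)))).
  apply: Rmult_lt_compat_r => //.
  apply: Rinv_0_lt_compat; apply: Rmult_lt_0_compat; lra.
have -> : e * (m * m) / 2 / (m * Cmod (f q)) = e * ((m / 2) / Cmod (f q)) by field; lra.
rewrite -[X in _ <= X]Rmult_1_r; apply: Rmult_le_compat_l; first lra.
by apply/Rle_div_l; lra.
Qed.

Lemma continuous_emb c (x : K c) : continuous (@emb c) x.
Proof.
apply/continuousP=> e e0; exists (e / 2); split; first lra.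
move=> q /emb_ball; lra.
Qed.

Lemma locally_embP c (x : K c) (P : K c -> Prop) :
  locally x P <-> exists d, 0 < d /\ forall y : K c, Cmod (emb y - emb x) < d -> P y.
Proof.
split.
  case/locallyP=> d [d0 H]; exists d; split=> // y /ball_emb; exact: H.
case=> d [d0 H]; apply/locallyP; exists (d / 2); split; first lra.
by move=> y /emb_ball Hy; apply: H; lra.
Qed.

(** Caratheodory's formulation of differentiability *)
Lemma is_deriv_of_slope c (f phi : K c -> C) (x : K c) :
  locally x (fun y => f y - f x = (emb y - emb x) * phi y)%C ->
  continuous phi x -> is_deriv f x (phi x).
Proof.
move=> /locally_embP[d1 [d10 H1]] /continuousP H; apply/is_derivP=> e e0.
have [d2 [d20 H2]] := H e e0.
exists (Rmin d1 d2); split; first exact: Rmin_pos.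
move=> y Hy.
have -> : (f y - f x - (emb y - emb x) * phi x = (phi y - phi x) * (emb y - emb x))%C.
  by rewrite H1; [ring|apply: Rlt_le_trans Hy (Rmin_l _ _)].
rewrite Cmod_mult; apply: Rmult_le_compat_r; first exact: Cmod_ge_0.
by left; apply: H2; apply: ball_emb; apply: Rlt_le_trans Hy (Rmin_r _ _).
Qed.

(** Converse of the slope criterion. The slope is the difference quotient off [x] and [l] at [x], so
    the factorization holds at every [y]; the product and chain rules then reduce to algebra and
    continuity. *)
Lemma is_deriv_slope c (f : K c -> C) (x : K c) (l : C) :
  is_deriv f x l -> exists phi : K c -> C,
    [/\ continuous phi x, phi x = l & forall y, (f y - f x = (emb y - emb x) * phi y)%C].
Proof.
move=> /is_derivP H.
exists (fun y => if excluded_middle_informative (y = x) then l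
                 else ((f y - f x) / (emb y - emb x))%C).
split; last first.
- move=> y; case: excluded_middle_informative => [e|ne] /=; first by subst y; ring.
  by field=> /Cminus_eq_0 h; apply: ne; apply: emb_inj.
- by case: excluded_middle_informative.
apply/continuousP=> e e0.
have [d [d0 Hd]] := H (e / 2) ltac:(lra).
exists (d / 2); split; first lra.
move=> y /emb_ball Hy.
case: (excluded_middle_informative (x = x)) => //= _.
case: excluded_middle_informative => [_|ne] /=.
  have -> : (l - l = RtoC 0)%C by ring.
  by rewrite Cmod_0.
have n0 : (emb y - emb x)%C <> RtoC 0 by move=> /Cminus_eq_0 h; apply: ne; apply: emb_inj.
have h := Hd y ltac:(lra).
have m0 := proj1 (Cmod_gt_0 _) n0.
have -> : ((f y - f x) / (emb y - emb x) - l
           = (f y - f x - (emb y - emb x) * l) / (emb y - emb x))%C by field.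
rewrite Cmod_div //.
apply: (Rle_lt_trans _ (e / 2)); last lra.
by apply/Rle_div_l.
Qed.

Lemma is_deriv_eqv c (f : K c -> C) (x : K c) (l l' : C) : is_deriv f x l -> l = l' -> is_deriv f x l'.
Proof. by move=> H <-. Qed.

Lemma is_deriv_continuous c (f : K c -> C) (x : K c) (l : C) : is_deriv f x l -> continuous f x.
Proof.
move=> /is_deriv_slope[phi [c1 _ H]].
apply: (continuous_Ceq (f := (fun y => f x + (emb y - emb x) * phi y)%C)).
  by move=> y; rewrite -H; ring.
apply: continuous_Cplus; first exact: continuous_Cconst.
apply: continuous_Cmult => //; apply: continuous_Cminus; first exact: continuous_emb.
exact: continuous_Cconst.
Qed.

Lemma is_deriv_const c (a : C) (x : K c) : is_deriv (fun _ => a) x (RtoC 0).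
Proof.
apply: (@is_deriv_of_slope c (fun _ => a) (fun _ => RtoC 0)); last exact: continuous_Cconst.
by apply: filter_forall => y; ring.
Qed.

Lemma is_deriv_emb c (x : K c) : is_deriv (@emb c) x (RtoC 1).
Proof.
apply: (@is_deriv_of_slope c (@emb c) (fun _ => RtoC 1)); last exact: continuous_Cconst.
by apply: filter_forall => y; ring.
Qed.

Lemma is_deriv_plus c (f g : K c -> C) (x : K c) (l m : C) :
  is_deriv f x l -> is_deriv g x m -> is_deriv (fun y => f y + g y)%C x (l + m)%C.
Proof.
move=> /is_deriv_slope[phi [c1 <- H1]] /is_deriv_slope[psi [c2 <- H2]].
apply: (@is_deriv_of_slope c (fun y => f y + g y)%C (fun y => phi y + psi y)%C); last exact: continuous_Cplus.
apply: filter_forall => y; rewrite Cmult_plus_distr_l -H1 -H2; ring.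
Qed.

Lemma is_deriv_mult c (f g : K c -> C) (x : K c) (l m : C) :
  is_deriv f x l -> is_deriv g x m -> is_deriv (fun y => f y * g y)%C x (l * g x + f x * m)%C.
Proof.
move=> H H'; have cg := is_deriv_continuous H'.
case/is_deriv_slope: H H' => [phi [c1 <- H1]] /is_deriv_slope[psi [c2 <- H2]].
apply: (@is_deriv_of_slope c (fun y => f y * g y)%C (fun y => phi y * g y + f x * psi y)%C).
  apply: filter_forall => y.
  transitivity ((f y - f x) * g y + f x * (g y - g x))%C; first by ring.
  by rewrite H1 H2; ring.
by apply: continuous_Cplus; apply: continuous_Cmult => //; apply: continuous_Cconst.
Qed.

Lemma is_deriv_scal c (f : K c -> C) (x : K c) (l a : C) :
  is_deriv f x l -> is_deriv (fun y => a * f y)%C x (a * l)%C.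
Proof.
move=> H; apply: is_deriv_eqv; first exact: (is_deriv_mult (is_deriv_const a x) H).
by move=> /=; ring.
Qed.

Lemma is_deriv_minus c (f g : K c -> C) (x : K c) (l m : C) :
  is_deriv f x l -> is_deriv g x m -> is_deriv (fun y => f y - g y)%C x (l - m)%C.
Proof.
move=> /is_deriv_slope[phi [c1 <- H1]] /is_deriv_slope[psi [c2 <- H2]].
apply: (@is_deriv_of_slope c (fun y => f y - g y)%C (fun y => phi y - psi y)%C); last exact: continuous_Cminus.
apply: filter_forall => y.
transitivity ((f y - f x) - (g y - g x))%C; first by ring.
by rewrite H1 H2; ring.
Qed.

Lemma is_deriv_comp c (f : K c -> C) (g : C -> C) (x : K c) (l m : C) :
  is_deriv f x l -> @is_deriv ComplexVars g (f x) m -> is_deriv (fun y => g (f y)) x (l * m)%C.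
Proof.
move=> H; have cf := is_deriv_continuous H.
case/is_deriv_slope: H => [phi [c1 <- H1]] /is_deriv_slope[psi [c2 <- H2]].
apply: (@is_deriv_of_slope c (fun y => g (f y)) (fun y => phi y * psi (f y))%C).
  by apply: filter_forall => y; rewrite H2 /= H1; ring.
by apply: continuous_Cmult => //; apply: (continuous_comp f psi).
Qed.

Lemma is_deriv_ext_loc c (f g : K c -> C) (x : K c) (l : C) :
  locally x (fun y => f y = g y) -> is_deriv f x l -> is_deriv g x l.
Proof.
move=> Hl /is_deriv_slope[phi [c1 <- H1]].
have e := locally_singleton _ _ Hl.
apply: is_deriv_of_slope => //.
by apply: filter_imp Hl => y <-; rewrite -e.
Qed.

Lemma is_deriv_inv c (f : K c -> C) (x : K c) (l : C) :
  is_deriv f x l -> f x <> RtoC 0 -> is_deriv (fun y => / f y)%C x (- l / (f x * f x))%C.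
Proof.
move=> H n0; have cf := is_deriv_continuous H.
case/is_deriv_slope: H => [phi [c1 <- H1]].
apply: (@is_deriv_of_slope c (fun y => / f y)%C (fun y => - phi y / (f y * f x))%C).
  have [d [d0 Hd]] := proj1 (continuousP _ _) cf _ (proj1 (Cmod_gt_0 _) n0).
  apply/locallyP; exists d; split=> // y /Hd Hy.
  have ny : f y <> RtoC 0.
    move=> e; move: Hy; rewrite e Cmod_minus_sym.
    have -> : (f x - 0 = f x)%C by ring.
    lra.
  transitivity (- (f y - f x) / (f y * f x))%C; first by field.
  by rewrite H1; field.
apply: continuous_Cmult.
  apply: (continuous_Ceq (f := (fun y => (- RtoC 1) * phi y)%C)); first by move=> y; ring.
  by apply: continuous_Cmult => //; apply: continuous_Cconst.
apply: continuous_Cinv; last exact: Cmult_neq_0.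
by apply: continuous_Cmult => //; apply: continuous_Cconst.
Qed.

Lemma is_deriv_unique c (f : K c -> C) (x : K c) (l m : C) :
  is_deriv f x l -> is_deriv f x m -> l = m.
Proof.
move=> /is_derivP H1 /is_derivP H2.
apply: Cminus_eq_0; apply: Cmod_eq_0; apply: Rle_antisym; last exact: Cmod_ge_0.
apply: le_epsilon => e e0; rewrite Rplus_0_l.
have [d1 [d10 {}H1]] := H1 (e / 2) ltac:(lra).
have [d2 [d20 {}H2]] := H2 (e / 2) ltac:(lra).
set t := Rmin d1 d2 / 2.
have t0 : 0 < t by rewrite /t; have := Rmin_pos _ _ d10 d20; lra.
have t1 : t < d1 by rewrite /t; have := Rmin_l d1 d2; have := Rmin_pos _ _ d10 d20; lra.
have t2 : t < d2 by rewrite /t; have := Rmin_r d1 d2; have := Rmin_pos _ _ d10 d20; lra.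
have [y Hy] := emb_shift x t.
have ct : Cmod (RtoC t) = t by rewrite Cmod_R Rabs_pos_eq; lra.
have := H1 y; have := H2 y; rewrite Hy ct => /(_ t2) h2 /(_ t1) h1.
have : Cmod (RtoC t * (l - m))%C <= e * t.
  have -> : (t * (l - m) = (f y - f x - t * m) - (f y - f x - t * l))%C by ring.
  apply: Rle_trans (Cmod_triangle _ _) _; rewrite Cmod_opp; lra.
rewrite Cmod_mult ct => h.
by apply: (Rmult_le_reg_l t) => //; lra.
Qed.

(** * Real and imaginary parts, and the mean value estimate *)

Lemma is_derive_Re (f : R -> C) (x : R) (l : C) :
  @is_deriv RealVars f x l -> is_derive (fun s => Re (f s)) x (Re l).
Proof.
move=> H; apply/is_derive_Reals => e e0.
have [d [d0 Hd]] := proj1 (@is_derivP RealVars f x l) H (e / 2) ltac:(lra).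
exists (mkposreal d d0) => h hn Hh.
have := Hd (Rplus x h); rewrite /= -RtoC_minus Cmod_R.
have -> : x + h - x = h by ring.
move=> /(_ Hh) hh.
have -> : (Re (f (Rplus x h)) - Re (f x)) / h - Re l = Re (f (Rplus x h) - f x - h * l)%C / h.
  by rewrite /Re /Cminus /Cplus /Copp /Cmult /RtoC /=; field.
rewrite Rabs_div //; apply: (Rle_lt_trans _ (e / 2)); last lra.
apply/Rle_div_l; first exact: Rabs_pos_lt.
by apply: Rle_trans hh; apply: re_le_Cmod.
Qed.

Lemma is_derive_Im (f : R -> C) (x : R) (l : C) :
  @is_deriv RealVars f x l -> is_derive (fun s => Im (f s)) x (Im l).
Proof.
move=> H.
have -> : Im l = Re (- Ci * l) by rewrite /Re /Im /=; ring.
apply: (is_derive_ext (fun s => Re (- Ci * f s)%C)).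
  by move=> s; rewrite /Re /Im /=; ring.
by apply: is_derive_Re; apply: is_deriv_scal.
Qed.

Lemma is_deriv_RtoC (f : R -> R) (x l : R) :
  is_derive f x l -> @is_deriv RealVars (fun s => RtoC (f s)) x (RtoC l).
Proof.
move/is_derive_Reals=> H; apply/is_derivP => e e0.
have [d Hd] := H e e0.
exists d; split; first exact: cond_pos.
move=> y; rewrite /= -!RtoC_minus -RtoC_mult -RtoC_minus !Cmod_R => Hy.
have [->|n0] := Req_dec y x.
  have -> : f x - f x - (x - x) * l = 0 by ring.
  rewrite Rminus_diag Rabs_R0; lra.
have n1 : y - x <> 0 by lra.
have := Hd _ n1 Hy; have -> : x + (y - x) = y by ring.
move=> h.
have -> : f y - f x - (y - x) * l = ((f y - f x) / (y - x) - l) * (y - x) by field.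
by rewrite Rabs_mult; apply: Rmult_le_compat_r; [exact: Rabs_pos|lra].
Qed.

Lemma is_deriv_deriv c (f : K c -> C) (x : K c) (l : C) : is_deriv f x l -> deriv f x = l.
Proof.
case: c f x => f x H; last exact: is_C_derive_unique.
rewrite /= (surjective_pairing l).
congr pair; apply: is_derive_unique; [exact: is_derive_Re|exact: is_derive_Im].
Qed.

(** Chain rule along a real affine path in [K c]. It reduces a complex derivative to a real one,
    both on segments and along the direction Re lambda. *)
Lemma is_deriv_affine c (f : K c -> C) (l : C) (seg : R -> K c) (a d : C) (t : R) :
  (forall s, emb (seg s) = a + RtoC s * d)%C -> is_deriv f (seg t) l ->
  @is_deriv RealVars (fun s => f (seg s)) t (d * l)%C.
Proof.
move=> Hs /is_deriv_slope[phi [c1 <- H1]].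
apply: (@is_deriv_of_slope RealVars (fun s => f (seg s)) (fun s => d * phi (seg s))%C).
  by apply: filter_forall => y; rewrite H1 !Hs /=; ring.
apply: continuous_Cmult; first exact: continuous_Cconst.
apply: (continuous_comp seg phi) => //.
have cd : continuous (fun s : R_UniformSpace => emb (seg s)) t.
  apply: (continuous_Ceq (f := (fun s => a + RtoC s * d)%C)) => //.
  apply: continuous_Cplus; first exact: continuous_Cconst.
  apply: continuous_Cmult; last exact: continuous_Cconst.
  exact: (@continuous_emb RealVars).
(* [emb] detects neighbourhoods, so continuity of [seg] follows from that of its affine image in
   C. *)
move=> P /locally_embP[e [e0 He]].
have [dd [d0 Hd]] := proj1 (continuousP _ _) cd e e0.
apply/locallyP; exists dd; split=> // q /Hd; exact: He.
Qed.

(** On the segment from [x0] to [x], subtracting the linear function of slope [l] leaves a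
    derivative of size at most [e] times the length. The real mean value theorem applies to Re and
    Im separately, at two different points; this costs the factor 2. *)
Lemma mvt_estimate c (f f' : K c -> C) (x0 x : K c) (l : C) (e : R) :
  (forall y : K c, Cmod (emb y - emb x0) <= Cmod (emb x - emb x0) ->
     is_deriv f y (f' y) /\ Cmod (f' y - l) <= e) ->
  Cmod (f x - f x0 - (emb x - emb x0) * l) <= 2 * e * Cmod (emb x - emb x0).
Proof.
move=> H.
have [seg Hseg] : exists seg : R -> K c, forall s, emb (seg s) = (emb x0 + RtoC s * (emb x - emb x0))%C.
  case: (c) x0 x {H} => x0 x /=.
    by exists (fun s => Rplus x0 (Rmult s (Rminus x x0))) => s; rewrite RtoC_plus RtoC_mult RtoC_minus.
  by exists (fun s => x0 + RtoC s * (x - x0))%C.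
have s0 : seg 0 = x0 by apply: emb_inj; rewrite Hseg; ring.
have s1 : seg 1 = x by apply: emb_inj; rewrite Hseg; ring.
set d := (emb x - emb x0)%C in H Hseg *.
set m := Cmod d.
have Hs t : 0 <= t <= 1 -> is_deriv f (seg t) (f' (seg t)) /\ Cmod (f' (seg t) - l) <= e.
  move=> Ht; apply: H; rewrite Hseg.
  have -> : (emb x0 + t * d - emb x0 = t * d)%C by ring.
  rewrite Cmod_mult Cmod_R Rabs_pos_eq; last lra.
  by have := Cmod_ge_0 d; nra.
set phi := fun s : R => (f (seg s) - RtoC s * (d * l))%C.
set dphi := fun s : R => (d * (f' (seg s) - l))%C.
have Dphi t : 0 <= t <= 1 -> @is_deriv RealVars phi t (dphi t).
  move=> /Hs[h1 _]; apply: is_deriv_eqv.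
    apply: is_deriv_minus; first exact: (is_deriv_affine Hseg h1).
    apply: is_deriv_mult; first exact: (@is_deriv_emb RealVars).
    exact: is_deriv_const.
  by rewrite /dphi /=; ring.
have Bphi t : 0 <= t <= 1 -> Cmod (dphi t) <= e * m.
  move=> /Hs[_ h]; rewrite Cmod_mult -/m Rmult_comm.
  by apply: Rmult_le_compat_r; first exact: Cmod_ge_0.
have e1 : (f x - f x0 - d * l = phi 1 - phi 0)%C by rewrite /phi s0 s1; ring.
have cont (g : R -> R) t l' : is_derive g t l' -> continuity_pt g t.
  by move=> hg; apply: derivable_continuous_pt; exists l'; apply/is_derive_Reals.
have R1 := Rle_0_1.
have [t1 [Ht1 E1]] : exists t, 0 <= t <= 1 /\ Re (phi 1) - Re (phi 0) = Re (dphi t).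
  have [|t ht|t [ht E]] := MVT_gen (fun s => Re (phi s)) 0 1 (fun s => Re (dphi s)).
  - rewrite Rmin_left // Rmax_right // => t ht; apply: is_derive_Re; apply: Dphi; lra.
  - rewrite Rmin_left // Rmax_right // in ht *; apply: (cont _ _ (Re (dphi t))); apply: is_derive_Re; exact: Dphi.
  - rewrite Rmin_left // Rmax_right // in ht; exists t; split=> //; lra.
have [t2 [Ht2 E2]] : exists t, 0 <= t <= 1 /\ Im (phi 1) - Im (phi 0) = Im (dphi t).
  have [|t ht|t [ht E]] := MVT_gen (fun s => Im (phi s)) 0 1 (fun s => Im (dphi s)).
  - rewrite Rmin_left // Rmax_right // => t ht; apply: is_derive_Im; apply: Dphi; lra.
  - rewrite Rmin_left // Rmax_right // in ht *; apply: (cont _ _ (Im (dphi t))); apply: is_derive_Im; exact: Dphi.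
  - rewrite Rmin_left // Rmax_right // in ht; exists t; split=> //; lra.
rewrite e1; apply: Rle_trans (Cmod_le_abs _) _.
have -> : Re (phi 1 - phi 0)%C = Re (dphi t1) by rewrite -E1.
have -> : Im (phi 1 - phi 0)%C = Im (dphi t2) by rewrite -E2.
have := re_le_Cmod (dphi t1); have := im_le_Cmod (dphi t2).
have := Bphi _ Ht1; have := Bphi _ Ht2; lra.
Qed.

Lemma deriv0_constant c (f : K c -> C) (x0 x : K c) :
  (forall y : K c, Cmod (emb y - emb x0) <= Cmod (emb x - emb x0) -> is_deriv f y (RtoC 0)) ->
  f x = f x0.
Proof.
move=> H; apply: Cminus_eq_0; apply: Cmod_eq_0; apply: Rle_antisym; last exact: Cmod_ge_0.
have e (z : C) : (z - 0 = z)%C by ring.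
rewrite -(e (f x - f x0)%C) -(Cmult_0_r (emb x - emb x0)).
(* Brings the goal into the shape of [mvt_estimate] with slope 0 and bound 0. *)
rewrite -[X in _ <= X](Rmult_0_l (Cmod (emb x - emb x0))) -[X in _ <= X * _](Rmult_0_r 2).
apply: mvt_estimate => y hy; split; first exact: H.
by rewrite e Cmod_0; lra.
Qed.

(** * Integrals of complex-valued functions and their dependence on a parameter *)

Notation RIntC := (@RInt C_R_CompleteNormedModule).
Notation ex_RIntC := (@ex_RInt C_R_NormedModule).
Notation is_RIntC := (@is_RInt C_R_NormedModule).

Lemma RIntC_correct (f : R -> C) (a b : R) : ex_RIntC f a b -> is_RIntC f a b (RIntC f a b).
Proof. exact: (@RInt_correct C_R_CompleteNormedModule). Qed.

Lemma is_RIntC_unique (f : R -> C) (a b : R) (l : C) : is_RIntC f a b l -> RIntC f a b = l.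
Proof. exact: (@is_RInt_unique C_R_CompleteNormedModule). Qed.

Lemma is_RIntC_plus (f g : R -> C) (a b : R) (l m : C) :
  is_RIntC f a b l -> is_RIntC g a b m -> is_RIntC (fun s => f s + g s)%C a b (l + m)%C.
Proof. exact: (@is_RInt_plus C_R_NormedModule). Qed.

(** The scalars of [C_R_NormedModule] are real, so multiplication by a complex [k] is assembled from
    the two coordinates. *)
Lemma is_RIntC_scal (f : R -> C) (a b : R) (k l : C) :
  is_RIntC f a b l -> is_RIntC (fun s => k * f s)%C a b (k * l)%C.
Proof.
move=> H.
have H1 := @is_RInt_fct_extend_fst R_NormedModule R_NormedModule f a b l H.
have H2 := @is_RInt_fct_extend_snd R_NormedModule R_NormedModule f a b l H.
have S1 k1 := @is_RInt_scal R_NormedModule _ a b k1 _ H1.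
have S2 k2 := @is_RInt_scal R_NormedModule _ a b k2 _ H2.
apply: (@is_RInt_fct_extend_pair R_NormedModule R_NormedModule).
  exact: (@is_RInt_minus R_NormedModule _ _ a b _ _ (S1 k.1) (S2 k.2)).
exact: (@is_RInt_plus R_NormedModule _ _ a b _ _ (S2 k.1) (S1 k.2)).
Qed.

Lemma is_RIntC_minus (f g : R -> C) (a b : R) (l m : C) :
  is_RIntC f a b l -> is_RIntC g a b m -> is_RIntC (fun s => f s - g s)%C a b (l - m)%C.
Proof. exact: (@is_RInt_minus C_R_NormedModule). Qed.

Lemma is_RIntC_bound (f : R -> C) (a b M : R) (l : C) : a <= b ->
  (forall s, a <= s <= b -> Cmod (f s) <= M) -> is_RIntC f a b l -> Cmod l <= (b - a) * M.
Proof.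
move=> ab H Hf; rewrite Cmod_norm.
by apply: (@norm_RInt_le_const C_R_NormedModule f a b l M ab _ Hf) => x /H; rewrite Cmod_norm.
Qed.

Lemma ex_RIntC_continuous (f : R -> C) (a b : R) : a <= b ->
  (forall s, a <= s <= b -> continuous f s) -> ex_RIntC f a b.
Proof.
move=> ab H; apply: (@ex_RInt_continuous C_R_CompleteNormedModule) => s.
by rewrite Rmin_left // Rmax_right //; apply: H.
Qed.

Lemma continuous_section (T : UniformSpace) (H : T -> R -> C) (p : T) (s : R) :
  continuous (fun q : prod_UniformSpace T R_UniformSpace => H q.1 q.2) (p, s) ->
  continuous (H p) s.
Proof.
move/continuousP=> h; apply/continuousP=> e /h[d [d0 Hd]].
exists d; split=> // q Hq; apply: (Hd (p, q)); split=> //=.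
by apply: (ball_center p (mkposreal d d0)).
Qed.

(** Compactness of [a, b]: continuity at each point of {p0} x [a, b] gives a radius depending on
    [s], and a Lebesgue number makes it uniform. This is the source of every uniform bound on
    integrands below. *)
Lemma tube_lemma (T : UniformSpace) (H : T -> R -> C) (p0 : T) (a b : R) :
  (forall s, a <= s <= b ->
    continuous (fun q : prod_UniformSpace T R_UniformSpace => H q.1 q.2) (p0, s)) ->
  forall e, 0 < e -> exists d, 0 < d /\
    forall p s, ball p0 d p -> a <= s <= b -> Cmod (H p s - H p0 s) < e.
Proof.
move=> Hc e e0.
have ch s : exists d : posreal, a <= s <= b -> forall p s', ball p0 d p -> ball s d s' ->
    Cmod (H p s' - H p0 s) < e / 2.
  case: (excluded_middle_informative (a <= s <= b)) => hs; last by exists (mkposreal 1 Rlt_0_1).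
  have /continuousP/(_ (e/2)) := Hc s hs; case; first lra.
  move=> d [d0 Hd]; exists (mkposreal d d0) => _ p s' h1 h2.
  exact: (Hd (p, s')).
have [delta Hdelta] : exists delta : R -> posreal, forall s, a <= s <= b -> forall p s',
    ball p0 (delta s) p -> ball s (delta s) s' -> Cmod (H p s' - H p0 s) < e / 2.
  exists (fun s => proj1_sig (constructive_indefinite_description _ (ch s))) => s.
  exact: (proj2_sig (constructive_indefinite_description _ (ch s))).
have [d Hd] := compactness_value_1d a b delta.
exists d; split; first exact: cond_pos.
move=> p s Hp Hs.
(* The covering point [t] is given under a double negation. Both [H p s] and [H p0 s] are then
   compared with [H p0 t], each within e / 2. *)
have [t [Ht [h1 h2]]] := NNPP _ (Hd s Hs).
have k1 := Hdelta t Ht p s (ball_le _ _ _ h2 _ Hp) h1.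
have k2 := Hdelta t Ht p0 s (ball_center _ _) h1.
have := Cmod_minus_triangle (H p s) (H p0 t) (H p0 s).
rewrite (Cmod_minus_sym (H p0 t)); lra.
Qed.

Lemma continuous_RIntC_param (T : UniformSpace) (H : T -> R -> C) (p0 : T) (a b : R) : a <= b ->
  locally p0 (fun p => forall s, a <= s <= b -> continuous (H p) s) ->
  (forall s, a <= s <= b ->
    continuous (fun q : prod_UniformSpace T R_UniformSpace => H q.1 q.2) (p0, s)) ->
  continuous (fun p => RIntC (H p) a b) p0.
Proof.
move=> ab Hl Hc; apply/continuousP=> e e0.
have [d1 [d10 H1]] := proj1 (locallyP _ _) Hl.
(* The summand 1 covers the case a = b and makes the final inequality strict. *)
have k0 : 0 < e / (b - a + 1) by apply: Rdiv_lt_0_compat; lra.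
have [d2 [d20 H2]] := tube_lemma Hc k0.
exists (Rmin d1 d2); split; first exact: Rmin_pos.
move=> p Hp.
have I1 := RIntC_correct (ex_RIntC_continuous ab (H1 p (ball_le _ _ _ (Rmin_l _ _) _ Hp))).
have I0 := RIntC_correct (ex_RIntC_continuous ab (locally_singleton _ _ Hl)).
have := is_RIntC_bound ab _ (is_RIntC_minus I1 I0).
move=> /(_ (e / (b - a + 1))) h.
apply: Rle_lt_trans (h _) _.
  by move=> s Hs; left; apply: H2 => //; apply: ball_le Hp; apply: Rmin_r.
have -> : e = (b - a + 1) * (e / (b - a + 1)) by field; lra.
have -> : (b - a + 1) * (e / (b - a + 1)) / (b - a + 1) = e / (b - a + 1) by field; lra.
apply: Rmult_lt_compat_r; lra.
Qed.

(** For fixed [s], the first-order remainder of [h] is controlled by [mvt_estimate] with slope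
    [dh z0 s]. The tube lemma makes that bound uniform in [s], so it survives integration. *)
Lemma is_deriv_RIntC_param c (h dh : K c -> R -> C) (z0 : K c) (a b : R) : a <= b ->
  locally z0 (fun z => forall s, a <= s <= b ->
    continuous (h z) s /\ is_deriv (fun y => h y s) z (dh z s)) ->
  (forall s, a <= s <= b ->
    continuous (fun q : prod_UniformSpace (K c) R_UniformSpace => dh q.1 q.2) (z0, s)) ->
  is_deriv (fun z => RIntC (h z) a b) z0 (RIntC (dh z0) a b).
Proof.
move=> ab Hl Hc; apply/is_derivP=> e e0.
have [d1 [d10 H1]] := proj1 (locally_embP _ _) Hl.
(* The 2 offsets the factor 2 of [mvt_estimate]. *)
have k0 : 0 < e / (2 * (b - a + 1)) by apply: Rdiv_lt_0_compat; lra.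
have [d2 [d20 H2]] := tube_lemma Hc k0.
exists (Rmin d1 d2); split; first exact: Rmin_pos.
move=> z Hz.
have Ih y : Cmod (emb y - emb z0) < d1 -> is_RIntC (h y) a b (RIntC (h y) a b).
  move=> Hy; apply: RIntC_correct; apply: (ex_RIntC_continuous ab) => s Hs; exact: (proj1 (H1 y Hy s Hs)).
have z00 : Cmod (emb z0 - emb z0) < d1.
  have -> : (emb z0 - emb z0 = RtoC 0)%C by ring.
  by rewrite Cmod_0.
have I1 := Ih _ (Rlt_le_trans _ _ _ Hz (Rmin_l _ _)).
have I0 := Ih _ z00.
have Id : is_RIntC (dh z0) a b (RIntC (dh z0) a b).
  by apply: RIntC_correct; apply: (ex_RIntC_continuous ab) => s /Hc; apply: continuous_section.
set m := Cmod (emb z - emb z0).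
have I := is_RIntC_minus (is_RIntC_minus I1 I0) (@is_RIntC_scal _ _ _ (emb z - emb z0)%C _ Id).
have := is_RIntC_bound ab _ I.
move=> /(_ (2 * (e / (2 * (b - a + 1))) * m)) B.
apply: Rle_trans (B _) _.
  move=> s Hs; apply: (mvt_estimate (f := fun y => h y s) (f' := fun y => dh y s)) => y Hy.
  have hy := Rle_lt_trans _ _ _ Hy Hz.
  split; first exact: (proj2 (H1 y (Rlt_le_trans _ _ _ hy (Rmin_l _ _)) s Hs)).
  left; apply: H2 => //; apply: ball_emb; apply: Rlt_le_trans hy (Rmin_r _ _).
rewrite -Rmult_assoc; apply: Rmult_le_compat_r; first exact: Cmod_ge_0.
have -> : 2 * (e / (2 * (b - a + 1))) = e / (b - a + 1) by field; lra.
have -> : (b - a) * (e / (b - a + 1)) = e * ((b - a) / (b - a + 1)) by field; lra.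
rewrite -[X in _ <= X]Rmult_1_r; apply: Rmult_le_compat_l; first lra.
by apply/Rle_div_l; lra.
Qed.

Lemma is_RIntC_deriv (f df : R -> C) (a b : R) : a <= b ->
  (forall s, a <= s <= b -> @is_deriv RealVars f s (df s)) ->
  (forall s, a <= s <= b -> continuous df s) ->
  is_RIntC df a b (f b - f a)%C.
Proof.
move=> ab H1 H2; apply: (@is_RInt_derive C_R_CompleteNormedModule);
  move=> s; rewrite Rmin_left // Rmax_right // => Hs; [exact: H1|exact: H2].
Qed.

(** * Circles as integration paths *)

Definition circle (z0 : C) (r : R) (s : R) : C := (z0 + r * (cos s + Ci * sin s))%C.
(** The velocity of the circle, written through the circle itself: divided by zeta - z0 it is the
    constant i, which gives the value 2 pi i at the center. *)
Definition dcircle (z0 : C) (r : R) (s : R) : C := (Ci * (circle z0 r s - z0))%C.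

Lemma Ci_sqr : (Ci * Ci = - RtoC 1)%C.
Proof. by rewrite /Ci /Cmult /Copp /RtoC /=; congr pair; ring. Qed.

Lemma is_deriv_circle (z0 : C) (r s : R) :
  @is_deriv RealVars (circle z0 r) s (dcircle z0 r s).
Proof.
apply: is_deriv_eqv.
  apply: is_deriv_plus; first exact: is_deriv_const.
  apply: is_deriv_scal; apply: is_deriv_plus.
    by apply: is_deriv_RtoC; apply: is_derive_cos.
  by apply: is_deriv_scal; apply: is_deriv_RtoC; apply: is_derive_sin.
rewrite /dcircle /circle RtoC_opp.
transitivity (r * ((Ci * Ci) * sin s + Ci * cos s))%C; first by rewrite Ci_sqr; ring.
ring.
Qed.

Lemma continuous_circle (z0 : C) (r s : R) : continuous (circle z0 r) s.
Proof. exact: is_deriv_continuous (is_deriv_circle z0 r s). Qed.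

Lemma continuous_dcircle (z0 : C) (r s : R) : continuous (dcircle z0 r) s.
Proof.
apply: continuous_Cmult; first exact: continuous_Cconst.
by apply: continuous_Cminus; [exact: continuous_circle|exact: continuous_Cconst].
Qed.

Lemma circle_closed (z0 : C) (r : R) : circle z0 r (2 * PI) = circle z0 r 0.
Proof. by rewrite /circle cos_2PI sin_2PI cos_0 sin_0. Qed.

Lemma Cmod_circle (z0 : C) (r s : R) : 0 <= r -> Cmod (circle z0 r s - z0) = r.
Proof.
move=> r0; have -> : (circle z0 r s - z0 = r * (cos s + Ci * sin s))%C by rewrite /circle; ring.
rewrite Cmod_mult Cmod_R Rabs_pos_eq //.
have -> : Cmod (cos s + Ci * sin s) = 1; last by ring.
rewrite /Cmod -sqrt_1; congr sqrt => /=.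
have := sin2_cos2 s; rewrite /Rsqr => E.
by transitivity (sin s * sin s + cos s * cos s); [ring|].
Qed.

Lemma circle_neq (z0 w : C) (r s : R) : Cmod (w - z0) < r -> (circle z0 r s - w)%C <> RtoC 0.
Proof.
move=> h /Cminus_eq_0 e.
have r0 : 0 <= r by have := Cmod_ge_0 (w - z0); lra.
have := Cmod_circle z0 s r0; rewrite e; lra.
Qed.
Arguments circle_neq {z0 w r} s _.

Lemma PI2_pos : 0 <= 2 * PI.
Proof. have := PI_RGT_0; lra. Qed.

Lemma continuous_fstC (T : UniformSpace) (S : UniformSpace) (f : T -> C) (p : T * S) :
  continuous f p.1 -> continuous (fun q : prod_UniformSpace T S => f q.1) p.
Proof. move=> h; apply: (continuous_comp fst f) => //; exact: continuous_fst. Qed.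

Lemma continuous_sndC (T : UniformSpace) (S : UniformSpace) (f : S -> C) (p : T * S) :
  continuous f p.2 -> continuous (fun q : prod_UniformSpace T S => f q.2) p.
Proof. move=> h; apply: (continuous_comp snd f) => //; exact: continuous_snd. Qed.

Lemma continuous_Cid (z : C) : continuous (fun w : C_UniformSpace => w : C) z.
Proof. exact: (@continuous_emb ComplexVars). Qed.

(** * Cauchy's formula on a disk *)

(** The Cauchy kernel pulled back to the parameter [s]; [ker2] and [ker3] are its first and second
    derivatives in [w]. *)
Definition ker1 (z0 : C) (r : R) (w : C) (s : R) : C := (dcircle z0 r s * / (circle z0 r s - w))%C.
Definition ker2 (z0 : C) (r : R) (w : C) (s : R) : C :=
  (dcircle z0 r s * (/ (circle z0 r s - w) * / (circle z0 r s - w)))%C.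
Definition ker3 (z0 : C) (r : R) (w : C) (s : R) : C :=
  (dcircle z0 r s * ((RtoC 1 + RtoC 1) * / (circle z0 r s - w) * / (circle z0 r s - w) * / (circle z0 r s - w)))%C.

Lemma continuous_inv_circle (z0 : C) (r : R) (w : C) (s : R) : Cmod (w - z0) < r ->
  continuous (fun q : prod_UniformSpace C_UniformSpace R_UniformSpace => / (circle z0 r q.2 - q.1))%C (w, s).
Proof.
move=> h; apply: continuous_Cinv; last exact: circle_neq.
apply: continuous_Cminus; first by apply: continuous_sndC; apply: continuous_circle.
by apply: (continuous_fstC (f := fun w : C_UniformSpace => w : C)); apply: continuous_Cid.
Qed.
Arguments continuous_inv_circle {z0 r w} s _.

Lemma continuous_ker (z0 : C) (r : R) (w : C) (s : R) : Cmod (w - z0) < r ->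
  [/\ continuous (fun q : prod_UniformSpace C_UniformSpace R_UniformSpace => ker1 z0 r q.1 q.2) (w, s),
   continuous (fun q : prod_UniformSpace C_UniformSpace R_UniformSpace => ker2 z0 r q.1 q.2) (w, s) &
   continuous (fun q : prod_UniformSpace C_UniformSpace R_UniformSpace => ker3 z0 r q.1 q.2) (w, s)].
Proof.
move=> h; have ci := continuous_inv_circle s h.
have cd : continuous (fun q : prod_UniformSpace C_UniformSpace R_UniformSpace => dcircle z0 r q.2) (w, s).
  by apply: continuous_sndC; apply: continuous_dcircle.
split; apply: continuous_Cmult => //; repeat (apply: continuous_Cmult => //).
by apply: continuous_Cconst.
Qed.
Arguments continuous_ker {z0 r w} s _.

Lemma is_deriv_inv_circle (z0 : C) (r : R) (w : C) (s : R) : Cmod (w - z0) < r ->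
  @is_deriv ComplexVars (fun w => / (circle z0 r s - w))%C w
    (/ (circle z0 r s - w) * / (circle z0 r s - w))%C.
Proof.
move=> h; have n0 := circle_neq s h.
apply: is_deriv_eqv.
  apply: (@is_deriv_inv ComplexVars (fun w => circle z0 r s - w)%C w) => //.
  by apply: is_deriv_minus; [exact: is_deriv_const|exact: (@is_deriv_emb ComplexVars)].
by rewrite /=; field.
Qed.
Arguments is_deriv_inv_circle {z0 r w} s _.

Lemma is_deriv_ker1 (z0 : C) (r : R) (w : C) (s : R) : Cmod (w - z0) < r ->
  @is_deriv ComplexVars (fun w => ker1 z0 r w s) w (ker2 z0 r w s).
Proof. by move=> h; apply: is_deriv_scal; apply: is_deriv_inv_circle. Qed.

Lemma is_deriv_ker2 (z0 : C) (r : R) (w : C) (s : R) : Cmod (w - z0) < r ->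
  @is_deriv ComplexVars (fun w => ker2 z0 r w s) w (ker3 z0 r w s).
Proof.
move=> h; apply: is_deriv_scal; have d := is_deriv_inv_circle s h.
apply: is_deriv_eqv; first exact: (is_deriv_mult d d).
by move=> /=; ring.
Qed.

Lemma locally_disk (z0 w : C) (r : R) : Cmod (w - z0) < r ->
  locally (w : C_UniformSpace) (fun y : C => Cmod (y - z0) < r).
Proof.
move=> h; apply/(@locally_embP ComplexVars); exists (r - Cmod (w - z0)); split; first lra.
by move=> y /= hy; have := Cmod_minus_triangle y w z0; lra.
Qed.

(** The integral is constant in [w]: its derivative integrates [ker2], which is the [s]-derivative
    of -1 / (zeta - w), around a closed circle. At the center the integrand is the constant i. *)
Lemma RIntC_ker1 (z0 w : C) (r : R) : Cmod (w - z0) < r ->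
  RIntC (ker1 z0 r w) 0 (2 * PI) = (RtoC 2 * PI * Ci)%C.
Proof.
move=> h; have pi0 := PI2_pos.
have r0 : 0 < r by have := Cmod_ge_0 (w - z0); lra.
have D y : Cmod (y - z0) < r ->
    @is_deriv ComplexVars (fun w => RIntC (ker1 z0 r w) 0 (2 * PI)) y (RtoC 0).
  move=> hy; apply: is_deriv_eqv.
    apply: (@is_deriv_RIntC_param ComplexVars (ker1 z0 r) (ker2 z0 r)) => //.
    - apply: filter_imp (locally_disk hy) => v hv s _.
      have [c1 c2 _] := continuous_ker s hv.
      by split; [exact: (continuous_section (H := ker1 z0 r))|exact: is_deriv_ker1].
    - by move=> s _; have [] := continuous_ker s hy.
  apply: is_RIntC_unique.
  have -> : RtoC 0 = (- / (circle z0 r (2 * PI) - y) - - / (circle z0 r 0 - y))%C.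
    by rewrite circle_closed; ring.
  apply: (is_RIntC_deriv (f := fun s => (- / (circle z0 r s - y))%C)) => // s _; last first.
    by have [_ c2 _] := continuous_ker s hy; apply: (continuous_section (H := ker2 z0 r)).
  apply: (@is_deriv_ext_loc RealVars (fun s => (- RtoC 1) * / (circle z0 r s - y))%C).
    by apply: filter_forall => v; ring.
  apply: is_deriv_eqv.
    apply: is_deriv_scal; apply: (@is_deriv_inv RealVars (fun s => circle z0 r s - y)%C s _ _ (circle_neq s hy)).
    by apply: is_deriv_minus; [exact: is_deriv_circle|exact: is_deriv_const].
  by rewrite /ker2; field; apply: circle_neq.
have c0 : RIntC (ker1 z0 r z0) 0 (2 * PI) = (RtoC 2 * PI * Ci)%C.
  apply: is_RIntC_unique.
  have -> : (RtoC 2 * PI * Ci = Ci * RtoC (2 * PI) - Ci * RtoC 0)%C by rewrite RtoC_mult; ring.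
  apply: (is_RIntC_deriv (f := fun s => (Ci * RtoC s)%C)) => // s _; last first.
    have hz : Cmod (z0 - z0) < r by have -> : (z0 - z0 = RtoC 0)%C by [ring]; rewrite Cmod_0.
    by have [c1 _ _] := continuous_ker s hz; apply: (continuous_section (H := ker1 z0 r)).
  apply: is_deriv_eqv; first by apply: is_deriv_scal; exact: (@is_deriv_emb RealVars).
  have n0 : (circle z0 r s - z0)%C <> RtoC 0.
    by apply: circle_neq; have -> : (z0 - z0 = RtoC 0)%C by [ring]; rewrite Cmod_0.
  by rewrite /ker1 /dcircle; field.
rewrite -c0.
apply: (@deriv0_constant ComplexVars (fun w => RIntC (ker1 z0 r w) 0 (2 * PI)) z0 w) => y /= hy.
by apply: D; lra.
Qed.

(* The integral of f (w + t (zeta - w)) / (zeta - w) does not depend on t: its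
   t-derivative is the contour integral of an exact derivative.  The points
   w + t (zeta - w) with |t| <= 2 stay within 5 r of z0. *)
Lemma cauchy_formula (f df : C -> C) (z0 w : C) (r : R) :
  (forall z, Cmod (z - z0) < 6 * r ->
    @is_deriv ComplexVars f z (df z) /\ continuous (df : C_UniformSpace -> C) z) ->
  Cmod (w - z0) < r ->
  RIntC (fun s => f (circle z0 r s) * ker1 z0 r w s)%C 0 (2 * PI) = (RtoC 2 * PI * Ci * f w)%C.
Proof.
move=> Hf h; have pi0 := PI2_pos.
have r0 : 0 < r by have := Cmod_ge_0 (w - z0); lra.
pose pt (t s : R) : C := (w + t * (circle z0 r s - w))%C.
have inD t s : -2 <= t <= 2 -> Cmod (pt t s - z0) < 6 * r.
  move=> ht.
  have -> : (pt t s - z0 = RtoC (1 - t) * (w - z0) + t * (circle z0 r s - z0))%C.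
    by rewrite /pt RtoC_minus; ring.
  apply: Rle_lt_trans (Cmod_triangle _ _) _.
  rewrite !Cmod_mult !Cmod_R Cmod_circle; last lra.
  have a1 : Rabs (1 - t) <= 3 by apply: Rabs_le; lra.
  have a2 : Rabs t <= 2 by apply: Rabs_le; lra.
  have := Rmult_le_compat_r r _ _ ltac:(lra) a2.
  have := Rmult_le_compat_r _ _ _ (Cmod_ge_0 (w - z0)) a1.
  lra.
pose h0 (t s : R) : C := (f (pt t s) * ker1 z0 r w s)%C.
pose h1 (t s : R) : C := (df (pt t s) * dcircle z0 r s)%C.
have cpt (t s : R) : continuous (fun q : prod_UniformSpace R_UniformSpace R_UniformSpace => pt q.1 q.2) (t, s).
  apply: continuous_Cplus; first exact: continuous_Cconst.
  apply: continuous_Cmult.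
    by apply: (@continuous_fstC _ _ RtoC); apply: (@continuous_emb RealVars).
  apply: (@continuous_sndC _ _ (fun s => circle z0 r s - w)%C).
  by apply: continuous_Cminus; [exact: continuous_circle|exact: continuous_Cconst].
have ch1 t s : -2 <= t <= 2 ->
    continuous (fun q : prod_UniformSpace R_UniformSpace R_UniformSpace => h1 q.1 q.2) (t, s).
  move=> ht; apply: continuous_Cmult.
    apply: (continuous_comp (fun q => pt q.1 q.2) df); first exact: cpt.
    by have [] := Hf _ (inD t s ht).
  by apply: continuous_sndC; apply: continuous_dcircle.
have ch0 t s : -2 <= t <= 2 -> continuous (h0 t) s.
  move=> ht; apply: continuous_Cmult.
    apply: (continuous_comp (pt t) f); first exact: (continuous_section (H := pt)).
    by have [/is_deriv_continuous] := Hf _ (inD t s ht).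
  by have [c1 _ _] := continuous_ker s h; apply: (continuous_section (H := ker1 z0 r)).
(* [deriv0_constant] wants the whole ball |t| <= 1, hence negative [t]; differentiating under the
   integral needs a neighbourhood of each such [t], hence the range |t| <= 2 above. *)
have Dg t : -1 <= t <= 1 -> @is_deriv RealVars (fun t => RIntC (h0 t) 0 (2 * PI)) t (RtoC 0).
  move=> ht; apply: is_deriv_eqv.
    apply: (@is_deriv_RIntC_param RealVars h0 h1) => //; last by move=> s _; apply: ch1; lra.
    apply/locallyP; exists 1; split; first lra.
    move=> y hy s _.
    have hy2 : -2 <= y <= 2 by have /Rabs_def2 : Rabs (y - t) < 1 by [exact: hy]; lra.
    split; first exact: ch0.
    have [d _] := Hf _ (inD y s hy2).
    apply: is_deriv_eqv.
      apply: is_deriv_mult; last exact: is_deriv_const.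
      apply: (@is_deriv_affine ComplexVars f (df (pt y s)) (fun t => pt t s) w (circle z0 r s - w)%C) => //.
    (* Differentiating in [t] produces the factor zeta - w, which cancels the denominator of the
       kernel. *)
    rewrite /h1 /ker1; field; exact: circle_neq.
  apply: is_RIntC_unique.
  (* The primitive in [s] is f (pt t s) / t for nonzero [t]; at t = 0 it is df w times zeta. *)
  have [t0|t0] := Req_dec t 0.
    have -> : RtoC 0 = (df w * circle z0 r (2 * PI) - df w * circle z0 r 0)%C.
      by rewrite circle_closed; ring.
    apply: (is_RIntC_deriv (f := fun s => (df w * circle z0 r s)%C)) => // s _; last first.
      by apply: (continuous_section (H := h1)); apply: ch1; lra.
    rewrite /h1 /pt t0; have -> : (w + 0 * (circle z0 r s - w) = w)%C by ring.
    by apply: is_deriv_scal; apply: is_deriv_circle.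
  have t0' : RtoC t <> RtoC 0 by move=> [].
  have -> : RtoC 0 = (/ t * f (pt t (Rmult 2 PI)) - / t * f (pt t 0))%C.
    by rewrite /pt circle_closed; ring.
  apply: (is_RIntC_deriv (f := fun s => (/ t * f (pt t s))%C)) => // s _; last first.
    by apply: (continuous_section (H := h1)); apply: ch1; lra.
  have [d _] := Hf _ (inD t s ltac:(lra)).
  apply: is_deriv_eqv.
    apply: is_deriv_scal; apply: (@is_deriv_comp RealVars (pt t) f); last exact: d.
    apply: is_deriv_plus; first exact: is_deriv_const.
    apply: is_deriv_scal; apply: is_deriv_minus; [exact: is_deriv_circle|exact: is_deriv_const].
  by rewrite /h1; field.
(* At t = 1 the integrand is the Cauchy integrand of [f]; at t = 0 it is f w times the kernel. *)
have E : RIntC (h0 1) 0 (2 * PI) = RIntC (h0 0) 0 (2 * PI).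
  apply: (@deriv0_constant RealVars (fun t => RIntC (h0 t) 0 (2 * PI)) 0 1) => y.
  rewrite /= -!RtoC_minus !Cmod_R !Rminus_0_r (Rabs_pos_eq 1); last lra.
  by move=> /Rabs_le_between hy; apply: Dg.
transitivity (RIntC (h0 1) 0 (2 * PI)).
  congr (RIntC _ _ _); apply: functional_extensionality => s.
  by rewrite /h0 /pt; congr (f _ * _)%C; ring.
rewrite E -(RIntC_ker1 h).
have c1 : ex_RIntC (ker1 z0 r w) 0 (2 * PI).
  apply: ex_RIntC_continuous => // s _.
  by have [c1 _ _] := continuous_ker s h; apply: (continuous_section (H := ker1 z0 r)).
rewrite Cmult_comm -(is_RIntC_unique (@is_RIntC_scal _ _ _ (f w) _ (RIntC_correct c1))).
congr (RIntC _ _ _); apply: functional_extensionality => s.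
by rewrite /h0 /pt; congr (f _ * _)%C; ring.
Qed.

(** * Updating one coordinate of a point *)

Lemma upd_same (I : finType) (A : Type) (p : I -> A) i s : upd p i s i = s.
Proof. by rewrite /upd eqxx. Qed.

Lemma upd_id (I : finType) (A : Type) (p : I -> A) i : upd p i (p i) = p.
Proof. by apply: functional_extensionality => j; rewrite /upd; case: eqP => [->|]. Qed.

Lemma upd_upd (I : finType) (A : Type) (p : I -> A) i s t : upd (upd p i s) i t = upd p i t.
Proof. by apply: functional_extensionality => j; rewrite /upd; case: eqP. Qed.

Lemma upd_comm (I : finType) (A : Type) (p : I -> A) i j s t : i != j ->
  upd (upd p i s) j t = upd (upd p j t) i s.
Proof.
move=> ij; apply: functional_extensionality => k; rewrite /upd.
by case: eqP => [->|//]; rewrite eq_sym (negbTE ij).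
Qed.

Lemma upd_neq (I : finType) (A : Type) (p : I -> A) i j s : i != j -> upd p i s j = p j.
Proof. by rewrite /upd eq_sym => /negbTE ->. Qed.

Lemma continuous_upd (T : UniformSpace) (I : finType) c (u : T -> pts c I) (v : T -> K c) q i :
  continuous u q -> continuous v q -> continuous (fun q => upd (u q) i (v q) : pts c I) q.
Proof.
move=> /filterlim_locally hu /filterlim_locally hv; apply/filterlim_locally => e.
apply: filter_imp (filter_and _ _ (hu e) (hv e)) => y [h1 h2] j.
rewrite /upd; case: eqP => _; [exact: h2|exact: h1].
Qed.

Lemma continuous_coord (I : finType) c (p : pts c I) i : continuous (fun p : pts c I => p i) p.
Proof.
apply/filterlim_locally => e; exists e => y; exact.
Qed.

Lemma continuous_line (I : finType) c (p : pts c I) i (s : K c) :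
  continuous (fun s : K c => upd p i s : pts c I) s.
Proof. apply: (continuous_upd (u := fun _ => p)); [exact: continuous_const|exact: continuous_id]. Qed.

Lemma is_pd_upd (I : finType) c i (f : pts c I -> C) (p : pts c I) z l :
  is_pd i f (upd p i z) l <-> is_deriv (fun s => f (upd p i s)) z l.
Proof.
rewrite /is_pd upd_same.
have -> : (fun s => f (upd (upd p i z) i s)) = (fun s => f (upd p i s)) => //.
by apply: functional_extensionality => s; rewrite upd_upd.
Qed.

Lemma is_pd_ext_loc (I : finType) c i (f g : pts c I -> C) (p : pts c I) l :
  locally p (fun q => f q = g q) -> is_pd i f p l -> is_pd i g p l.
Proof.
rewrite -{1}(upd_id p i) => h; apply: is_deriv_ext_loc.
exact: (continuous_line h).
Qed.

Lemma is_pd_pd (I : finType) c i (f : pts c I -> C) (p : pts c I) l : is_pd i f p l -> pd i f p = l.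
Proof. exact: is_deriv_deriv. Qed.

(** * Regularity of analytic functions of several variables *)

(** Cauchy integral in the i-th variable. The coordinate [p i] enters only through the kernel and
    the others only through [F], so a derivative along i falls on the kernel and one along j != i
    falls on [F]. *)
Definition circle_int (I : finType) (i : I) (z0 : C) (r : R) (F : pts ComplexVars I -> C)
    (k : C -> R -> C) (p : pts ComplexVars I) : C :=
  RIntC (fun s => F (upd p i (circle z0 r s)) * k (p i) s)%C 0 (2 * PI).

Notation uncont k w s :=
  (continuous (fun q : prod_UniformSpace C_UniformSpace R_UniformSpace => k q.1 q.2) (w, s)).

(** The point [u] fed to [F] and the argument [v] of the kernel vary independently, which covers
    three uses: both move, only the kernel moves, only [F] moves. *)
Lemma continuous_circle_integrand (T : UniformSpace) (I : finType) (i : I) z0 r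
    (F : pts ComplexVars I -> C) (k : C -> R -> C) (u : T -> pts ComplexVars I) (v : T -> C_UniformSpace) (p : T) (s : R) :
  continuous u p -> continuous v p ->
  continuous F (upd (u p) i (circle z0 r s)) -> uncont k (v p) s ->
  continuous (fun q : prod_UniformSpace T R_UniformSpace =>
    F (upd (u q.1) i (circle z0 r q.2)) * k (v q.1) q.2)%C (p, s).
Proof.
move=> cu cv cF ck; apply: continuous_Cmult.
  apply: (continuous_comp (fun q : prod_UniformSpace T R_UniformSpace =>
     upd (u q.1) i (circle z0 r q.2) : pts ComplexVars I) F) => //.
  apply: (@continuous_upd _ I ComplexVars (fun q : prod_UniformSpace T R_UniformSpace => u q.1)
     (fun q : prod_UniformSpace T R_UniformSpace => circle z0 r q.2)).
    apply: (continuous_comp fst u) => //; exact: continuous_fst.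
  by apply: continuous_sndC; apply: continuous_circle.
apply: (continuous_comp (fun q : prod_UniformSpace T R_UniformSpace =>
   (v q.1, q.2) : prod_UniformSpace C_UniformSpace R_UniformSpace)
   (fun q : prod_UniformSpace C_UniformSpace R_UniformSpace => k q.1 q.2)) => //.
apply/filterlim_locally => e.
have [d [d0 Hd]] := proj1 (locallyP _ _) (proj1 (filterlim_locally _ _) cv e).
apply/locallyP; exists (Rmin d e); split; first by apply: Rmin_pos => //; exact: cond_pos.
move=> q [h1 h2]; split => /=.
  by apply: Hd; apply: ball_le h1; exact: Rmin_l.
by apply: ball_le h2; exact: Rmin_r.
Qed.

Lemma continuous_circle_int (I : finType) (i : I) z0 r (F : pts ComplexVars I -> C) k
    (p : pts ComplexVars I) :
  locally p (fun q => forall s, continuous F (upd q i (circle z0 r s)) /\ uncont k (q i) s) ->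
  continuous (circle_int i z0 r F k) p.
Proof.
move=> H.
have cc q s : continuous F (upd q i (circle z0 r s)) /\ uncont k (q i) s ->
    continuous (fun q : prod_UniformSpace (pts ComplexVars I) R_UniformSpace =>
    F (upd q.1 i (circle z0 r q.2)) * k (q.1 i) q.2)%C (q, s).
  move=> [h1 h2].
  apply: (@continuous_circle_integrand _ I i z0 r F k (fun q => q) (fun q => q i)) => //.
  exact: continuous_coord.
apply: continuous_RIntC_param; first exact: PI2_pos.
  apply: filter_imp H => q Hq s _.
  apply: (continuous_section (H := fun q s => F (upd q i (circle z0 r s)) * k (q i) s)%C).
  exact: cc.
by move=> s _; apply: cc; apply: (locally_singleton _ _ H).
Qed.

Lemma is_pd_circle_int_ker (I : finType) (i : I) z0 r (F : pts ComplexVars I -> C) (k dk : C -> R -> C)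
    (p : pts ComplexVars I) :
  (forall s, continuous F (upd p i (circle z0 r s))) ->
  locally (p i) (fun w : C => forall s,
    [/\ uncont k w s, uncont dk w s & @is_deriv ComplexVars (fun y => k y s) w (dk w s)]) ->
  is_pd i (circle_int i z0 r F k) p (circle_int i z0 r F dk p).
Proof.
move=> cF Hk; rewrite /is_pd /circle_int.
pose h (kk : C -> R -> C) (w : C) (s : R) := (F (upd p i (circle z0 r s)) * kk w s)%C.
apply: (@is_deriv_ext_loc ComplexVars (fun w => RIntC (h k w) 0 (2 * PI))).
  apply: filter_forall => w; congr (RIntC _ _ _).
  by apply: functional_extensionality => s; rewrite /h upd_upd upd_same.
have ch kk w s : uncont kk w s -> uncont (h kk) w s.
  move=> hk; apply: (@continuous_circle_integrand C_UniformSpace I i z0 r F kk (fun _ => p) (fun w => w)) => //.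
    exact: continuous_const.
apply: (@is_deriv_RIntC_param ComplexVars (h k) (h dk)); first exact: PI2_pos.
  apply: filter_imp Hk => w Hw s _; have [h1 h2 h3] := Hw s; split.
    by apply: (continuous_section (H := h k)); apply: ch.
  exact: is_deriv_scal.
by move=> s _; apply: ch; have [] := locally_singleton _ _ Hk s.
Qed.

Lemma is_pd_circle_int_fun (I : finType) (i j : I) z0 r (F G : pts ComplexVars I -> C) (k : C -> R -> C)
    (p : pts ComplexVars I) : j != i ->
  locally p (fun q => forall s, [/\ continuous F (upd q i (circle z0 r s)),
     continuous G (upd q i (circle z0 r s)) & is_pd j F (upd q i (circle z0 r s)) (G (upd q i (circle z0 r s)))]) ->
  (forall s, uncont k (p i) s) ->
  is_pd j (circle_int i z0 r F k) p (circle_int i z0 r G k p).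
Proof.
move=> ji Hp Hk; rewrite /is_pd.
have {}Hp : locally (p j) (fun w : K ComplexVars => forall s,
     [/\ continuous F (upd (upd p j w) i (circle z0 r s)),
     continuous G (upd (upd p j w) i (circle z0 r s)) & is_pd j F (upd (upd p j w) i (circle z0 r s)) (G (upd (upd p j w) i (circle z0 r s)))]).
  by move: Hp; rewrite -{1}(upd_id p j) => Hp; exact: (continuous_line Hp).
pose h (F : pts ComplexVars I -> C) (w : C) (s : R) := (F (upd (upd p j w) i (circle z0 r s)) * k (p i) s)%C.
apply: (@is_deriv_ext_loc ComplexVars (fun w => RIntC (h F w) 0 (2 * PI))).
  apply: filter_forall => w; congr (RIntC _ _ _).
  by apply: functional_extensionality => s; rewrite /h (upd_neq p) // /upd eq_sym (negbTE ji).
have ch F' w s : continuous F' (upd (upd p j w) i (circle z0 r s)) -> uncont (h F') w s.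
  move=> hF; apply: (@continuous_circle_integrand C_UniformSpace I i z0 r F' k (fun w => upd p j w) (fun _ => p i)) => //.
    exact: (@continuous_line I ComplexVars).
  exact: continuous_const.
have -> : circle_int i z0 r G k p = RIntC (h G (p j)) 0 (2 * PI).
  by congr (RIntC _ _ _); apply: functional_extensionality => s; rewrite /h upd_id.
apply: (@is_deriv_RIntC_param ComplexVars (h F) (h G)); first exact: PI2_pos.
  apply: filter_imp Hp => w Hw s _; have [h1 h2 h3] := Hw s; split.
    by apply: (continuous_section (H := h F)); apply: ch.
  apply: is_deriv_eqv.
    apply: (@is_deriv_mult ComplexVars (fun w => F (upd (upd p j w) i (circle z0 r s))) (fun _ => k (p i) s)); last exact: is_deriv_const.
    apply: (@is_deriv_ext_loc ComplexVars (fun w => F (upd (upd p i (circle z0 r s)) j w))).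
      by apply: filter_forall => w'; rewrite upd_comm // eq_sym.
    by apply/(@is_pd_upd I ComplexVars); rewrite upd_comm 1?eq_sym //; exact: h3.
  by rewrite /h; ring.
by move=> s _; apply: ch; have [] := locally_singleton _ _ Hp s.
Qed.

Lemma two_pi_i_neq0 : (RtoC 2 * PI * Ci)%C <> RtoC 0.
Proof.
have pi0 := PI_RGT_0.
by apply: Cmult_neq_0; [apply: Cmult_neq_0|]; case; lra.
Qed.

(** Near [p0], Cauchy's formula in the variable i writes [f] with [ker1], hence [df i] with [ker2].
    Differentiating once more gives [ker3] against [f] if j = i, and [ker2] against [df j]
    otherwise; both integrals are continuous. *)
Lemma is_pd_continuous_partial (I : finType) (D : pts ComplexVars I -> Prop)
    (f : pts ComplexVars I -> C) (df : I -> pts ComplexVars I -> C) (i j : I) (p0 : pts ComplexVars I) :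
  open D -> D p0 ->
  (forall p, D p -> continuous f p) ->
  (forall k p, D p -> is_pd k f p (df k p) /\ continuous (df k) p) ->
  exists G : pts ComplexVars I -> C,
    locally p0 (fun p => is_pd j (df i) p (G p)) /\ continuous G p0.
Proof.
move=> oD Dp0 cf Hdf.
have [d [d0 Hd]] := proj1 (locallyP _ _) (oD p0 Dp0).
(* [cauchy_formula] asks for holomorphy on the disk of radius 6 r, which is d here. *)
set r := d / 6.
have r0 : 0 < r by rewrite /r; lra.
set z0 := (p0 i : C).
(* The points for which one fixed circle, centred at [p0 i], represents [f] in the variable i. *)
pose Good (p : pts ComplexVars I) :=
  Cmod (p i - z0) < r /\ forall z, Cmod (z - z0) < 6 * r -> D (upd p i z).
have lG : locally p0 Good.
  apply/locallyP; exists (r / 2); split; first lra.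
  move=> p Hp; split.
    by have := @emb_ball ComplexVars _ _ _ (Hp i); rewrite /= -/z0; lra.
  move=> z Hz; apply: Hd => j'; rewrite /upd; case: eqP => [->|_].
    apply: (@ball_emb ComplexVars (p0 i)); apply: Rlt_le_trans Hz _; rewrite /r; lra.
  by apply: ball_le (Hp j'); rewrite /r; lra.
have onc p s : Good p -> D (upd p i (circle z0 r s)).
  by move=> [_]; apply; rewrite Cmod_circle; lra.
have GD p : Good p -> D p by move=> [h1 h2]; rewrite -(upd_id p i); apply: h2; lra.
pose c0 := (/ (RtoC 2 * PI * Ci))%C.
have fE p : Good p -> f p = (c0 * circle_int i z0 r f (ker1 z0 r) p)%C.
  move=> [h1 h2].
  rewrite /circle_int (@cauchy_formula (fun z => f (upd p i z)) (fun z => df i (upd p i z))) //.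
    by rewrite upd_id /c0 Cmult_assoc Cinv_l ?Cmult_1_l //; exact: two_pi_i_neq0.
  move=> z /h2 Hz; have [k1 k2] := Hdf i _ Hz; split; first by apply/(@is_pd_upd I ComplexVars).
  by apply: (continuous_comp (fun z : K ComplexVars => upd p i z : pts ComplexVars I) (df i)) => //; apply: continuous_line.
have kers p : Good p -> locally (p i : C_UniformSpace) (fun w : C => Cmod (w - z0) < r).
  by move=> [h1 _]; apply: locally_disk.
have gE p : locally p Good -> df i p = (c0 * circle_int i z0 r f (ker2 z0 r) p)%C.
  move=> lp; have Gp := locally_singleton _ _ lp.
  have [k1 _] := Hdf i p (GD _ Gp).
  apply: (is_deriv_unique k1).
  apply: (@is_pd_ext_loc I ComplexVars i (fun p => c0 * circle_int i z0 r f (ker1 z0 r) p)%C).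
    by apply: filter_imp lp => q Gq; rewrite -fE.
  apply: is_deriv_scal; apply: is_pd_circle_int_ker.
    by move=> s; apply: cf; apply: onc.
  apply: filter_imp (kers p Gp) => w hw s; have [] := continuous_ker s hw.
  by split=> //; apply: is_deriv_ker1.
(* Each differentiation of an identity needs it on a neighbourhood; two are performed, hence the two
   nested uses. *)
have ll P : locally p0 P -> locally p0 (fun p => locally p P) by exact: locally_locally.
have [ij|/eqP ij] := eqVneq j i.
  exists (fun p => c0 * circle_int i z0 r f (ker3 z0 r) p)%C; split.
    apply: filter_imp (ll _ (ll _ lG)) => p lp.
    apply: (@is_pd_ext_loc I ComplexVars j (fun p => c0 * circle_int i z0 r f (ker2 z0 r) p)%C).
      by apply: filter_imp lp => q Gq; rewrite -gE.
    have Gp := locally_singleton _ _ (locally_singleton _ _ lp).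
    rewrite ij; apply: is_deriv_scal; apply: is_pd_circle_int_ker.
      by move=> s; apply: cf; apply: onc.
    apply: filter_imp (kers p Gp) => w hw s; have [] := continuous_ker s hw.
    by split=> //; apply: is_deriv_ker2.
  apply: continuous_Cmult; first exact: continuous_Cconst.
  apply: continuous_circle_int; apply: filter_imp lG => q Gq s.
  split; first by apply: cf; apply: onc.
  by have [] := continuous_ker s (proj1 Gq).
exists (fun p => c0 * circle_int i z0 r (df j) (ker2 z0 r) p)%C; split.
  apply: filter_imp (ll _ (ll _ lG)) => p lp.
  apply: (@is_pd_ext_loc I ComplexVars j (fun p => c0 * circle_int i z0 r f (ker2 z0 r) p)%C).
    by apply: filter_imp lp => q Gq; rewrite -gE.
  have lp' := locally_singleton _ _ lp.
  apply: is_deriv_scal; apply: is_pd_circle_int_fun; first exact/eqP.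
    apply: filter_imp lp' => q Gq s; have Dq := onc q s Gq; have [k1 k2] := Hdf j _ Dq.
    by split=> //; apply: cf.
  by move=> s; have [] := continuous_ker s (proj1 (locally_singleton _ _ lp')).
apply: continuous_Cmult; first exact: continuous_Cconst.
apply: continuous_circle_int; apply: filter_imp lG => q Gq s.
split; first by have [] := Hdf j _ (onc q s Gq).
by have [] := continuous_ker s (proj1 Gq).
Qed.

(** Puts the gain of one derivative into a form that iterates: the class defined by continuous first
    partials is stable under partial differentiation, so induction reaches every order. *)
Lemma analytic_partial (I : finType) (D : pts ComplexVars I -> Prop)
    (f g : pts ComplexVars I -> C) (i : I) :
  open D -> analytic D f -> (forall p, D p -> is_pd i f p (g p)) -> analytic D g.
Proof.
move=> oD [cf /= Hf] Hg.
have [df Hdf] : exists df : I -> pts ComplexVars I -> C,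
    forall k p, D p -> is_pd k f p (df k p) /\ continuous (df k) p.
  exists (fun k => proj1_sig (constructive_indefinite_description _ (Hf k))) => k p Dp.
  have [h1 [h2 _]] := proj2_sig (constructive_indefinite_description _ (Hf k)).
  by split; [exact: h1|exact: h2].
have gE p : D p -> df i p = g p.
  by move=> Dp; apply: (is_deriv_unique (proj1 (Hdf i p Dp)) (Hg p Dp)).
have lgE p : D p -> locally p (fun q => df i q = g q).
  by move=> /oD; apply: filter_imp.
split=> [p Dp|j].
  by apply: (continuous_ext_loc _ (df i)); [exact: lgE|exact: (proj2 (Hdf i p Dp))].
exists (pd j (df i)); split => [p Dp|].
  have [G [h1 h2]] := is_pd_continuous_partial i j oD Dp cf Hdf.
  have h := locally_singleton _ _ h1.
  by rewrite (is_pd_pd h); apply: is_pd_ext_loc h; apply: lgE.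
split=> // p Dp.
have [G [h1 h2]] := is_pd_continuous_partial i j oD Dp cf Hdf.
by apply: continuous_ext_loc h2; apply: filter_imp h1 => q /is_pd_pd.
Qed.

Lemma analytic_Ck (I : finType) (D : pts ComplexVars I -> Prop) (f : pts ComplexVars I -> C) n :
  open D -> analytic D f -> Ck (@is_pd ComplexVars I) n D f.
Proof.
move=> oD; elim: n f => [|n IH] f Hf; first by case: Hf.
split; first by case: Hf.
move=> j; have [g [Hg _]] := proj2 Hf j.
by exists g; split=> //; apply: IH; apply: analytic_partial Hg.
Qed.

Lemma regular_Ck c (I : finType) (D : pts c I -> Prop) (f : pts c I -> C) n :
  open D -> regular D f -> Ck (@is_pd c I) n D f.
Proof.
case: c D f => D f oD Hf; first exact: Hf.
exact: analytic_Ck.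
Qed.

(** * Symmetry of second derivatives *)

Lemma ball_upd c (I : finType) (p q : pts c I) (i : I) (s : K c) (d : R) :
  ball p d q -> Cmod (emb s - emb (p i)) < d -> ball p d (upd q i s : pts c I).
Proof.
by move=> h1 h2 j; rewrite /upd; case: eqP => [->|_]; [apply: ball_emb|apply: h1].
Qed.

(** Two nested mean value estimates: along i for the increment of [f] in direction j, then along j
    for [fi]. Each contributes a factor 2. *)
Lemma second_difference c (I : finType) (D : pts c I -> Prop) (f fi fij : pts c I -> C)
    (i j : I) (p : pts c I) :
  open D -> D p -> i != j ->
  (forall q, D q -> is_pd i f q (fi q) /\ is_pd j fi q (fij q)) -> continuous fij p ->
  forall e, 0 < e -> exists d, 0 < d /\ forall s t : K c,
    Cmod (emb s - emb (p i)) < d -> Cmod (emb t - emb (p j)) < d ->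
    Cmod ((f (upd (upd p i s) j t) - f (upd p i s)) - (f (upd p j t) - f p)
          - (emb s - emb (p i)) * ((emb t - emb (p j)) * fij p))
    <= 2 * (2 * e * Cmod (emb t - emb (p j))) * Cmod (emb s - emb (p i)).
Proof.
move=> oD Dp ij Hf /continuousP cij e e0.
have [d1 [d10 H1]] := proj1 (locallyP _ _) (oD p Dp).
have [d2 [d20 H2]] := cij e e0.
exists (Rmin d1 d2); split; first exact: Rmin_pos.
move=> s t Hs Ht.
have B y z : Cmod (emb y - emb (p i)) < Rmin d1 d2 -> Cmod (emb z - emb (p j)) < Rmin d1 d2 ->
    D (upd (upd p i y) j z) /\ Cmod (fij (upd (upd p i y) j z) - fij p) < e.
  move=> hy hz.
  have b : ball p (Rmin d1 d2) (upd (upd p i y) j z : pts c I).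
    apply: ball_upd => //; apply: ball_upd => //.
    exact: (ball_center p (mkposreal _ (Rmin_pos _ _ d10 d20))).
  by split; [apply: H1|apply: H2]; apply: ball_le b; [exact: Rmin_l|exact: Rmin_r].
have zz x : Cmod (emb x - @emb c x) < Rmin d1 d2.
  by have -> : (emb x - emb x = RtoC 0)%C by [ring]; rewrite Cmod_0; apply: Rmin_pos.
(* Reading this corner as an update of j to its own value puts it on the same j-line as the other
   corner. *)
have pj y : upd p i y = upd (upd p i y) j (p j).
  by rewrite upd_comm // upd_id.
have -> : (f (upd p j t) - f p = f (upd (upd p i (p i)) j t) - f (upd p i (p i)))%C by rewrite upd_id.
apply: (mvt_estimate (f := (fun y => f (upd (upd p i y) j t) - f (upd p i y))%C)
   (f' := (fun y => fi (upd (upd p i y) j t) - fi (upd p i y))%C)) => y Hy.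
have {}Hy := Rle_lt_trans _ _ _ Hy Hs.
split.
  apply: is_deriv_minus.
    have [D1 _] := B y t Hy Ht.
    apply: (@is_deriv_ext_loc c (fun y => f (upd (upd p j t) i y))).
      by apply: filter_forall => w; rewrite upd_comm // eq_sym.
    by apply/is_pd_upd; rewrite upd_comm 1?eq_sym //; case: (Hf _ D1).
  have [D1 _] := B y (p j) Hy (zz _).
  by apply/is_pd_upd; rewrite pj; case: (Hf _ D1).
rewrite [X in (_ - fi X)%C]pj.
apply: (mvt_estimate (f := fun z => fi (upd (upd p i y) j z))
   (f' := fun z => fij (upd (upd p i y) j z))) => z Hz.
have [D1 D2] := B y z Hy (Rle_lt_trans _ _ _ Hz Ht).
by split; [apply/is_pd_upd; case: (Hf _ D1)|left].
Qed.

(** The second difference is symmetric in i and j, so it approximates both mixed derivatives times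
    t^2, with the same real increment t in both directions. *)
Lemma schwarz c (I : finType) (D : pts c I -> Prop) (f fi fj fij fji : pts c I -> C)
    (i j : I) (p : pts c I) :
  open D -> D p -> i != j ->
  (forall q, D q -> is_pd i f q (fi q) /\ is_pd j fi q (fij q)) ->
  (forall q, D q -> is_pd j f q (fj q) /\ is_pd i fj q (fji q)) ->
  continuous fij p -> continuous fji p -> fij p = fji p.
Proof.
move=> oD Dp ij H1 H2 c1 c2.
apply: Cminus_eq_0; apply: Cmod_eq_0; apply: Rle_antisym; last exact: Cmod_ge_0.
apply: le_epsilon => e e0; rewrite Rplus_0_l.
(* Each second difference errs by 4 (e / 8) t^2, so the two together stay within e t^2. *)
have e8 : 0 < e / 8 by lra.
have [d1 [d10 {}H1]] := second_difference oD Dp ij H1 c1 e8.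
rewrite eq_sym in ij.
have [d2 [d20 {}H2]] := second_difference oD Dp ij H2 c2 e8.
set t := Rmin d1 d2 / 2.
have t0 : 0 < t by rewrite /t; have := Rmin_pos _ _ d10 d20; lra.
have t1 : t < d1 by rewrite /t; have := Rmin_l d1 d2; have := Rmin_pos _ _ d10 d20; lra.
have t2 : t < d2 by rewrite /t; have := Rmin_r d1 d2; have := Rmin_pos _ _ d10 d20; lra.
have ct : Cmod (RtoC t) = t by rewrite Cmod_R Rabs_pos_eq; lra.
have [x Hx] := emb_shift (p i) t; have [y Hy] := emb_shift (p j) t.
have := H1 x y; rewrite Hx Hy ct => /(_ t1 t1) {}H1.
have := H2 y x; rewrite Hx Hy ct => /(_ t2 t2); rewrite upd_comm // => {}H2.
have : Cmod (RtoC t * (t * (fij p - fji p)))%C <= e * (t * t).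
  have -> : (t * (t * (fij p - fji p)) =
    (f (upd (upd p i x) j y) - f (upd p j y) - (f (upd p i x) - f p) - t * (t * fji p))
    - (f (upd (upd p i x) j y) - f (upd p i x) - (f (upd p j y) - f p) - t * (t * fij p)))%C by ring.
  apply: Rle_trans (Cmod_triangle _ _) _; rewrite Cmod_opp; lra.
rewrite !Cmod_mult ct => h.
apply: (Rmult_le_reg_l (t * t)); [exact: Rmult_lt_0_compat|lra].
Qed.

(** * Closure properties of [Ck] *)

(** Lets closure properties be proved once for functions of t and of (t, lambda). The scalars [c]
    depend on the direction: those of lambda are real even when t is complex. *)
Definition line_op (T : UniformSpace) (J : Type) (op : J -> (T -> C) -> T -> C -> Prop) : Prop :=
  forall j p, exists (c : scalars) (ln : K c -> T) (s0 : K c),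
    ln s0 = p /\ forall f l, op j f p l <-> is_deriv (fun s => f (ln s)) s0 l.

Lemma line_op_pd c (I : finType) : line_op (@is_pd c I).
Proof. by move=> i p; exists c, (fun s => upd p i s), (p i); rewrite upd_id. Qed.

Lemma line_op_jpd c (I : finType) : line_op (@is_jpd c I).
Proof.
move=> [i|[]] [p z].
- by exists c, (fun s => (upd p i s, z)), (p i); rewrite upd_id.
- by exists RealVars, (fun s : R => (p, (Re z, s))), (Im z); split=> //; case: z.
- by exists RealVars, (fun s : R => (p, (s, Im z))), (Re z); split=> //; case: z.
Qed.

Lemma Ck_S (T : UniformSpace) (J : Type) (op : J -> (T -> C) -> T -> C -> Prop) n D f :
  Ck op n.+1 D f -> Ck op n D f.
Proof.
elim: n f => [|n IH] f [cf Hf]; first by split.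
by split=> // j; have [g [h1 h2]] := Hf j; exists g; split=> //; apply: IH.
Qed.

Lemma Ck_sub (T : UniformSpace) (J : Type) (op : J -> (T -> C) -> T -> C -> Prop) n
    (D E : T -> Prop) f : (forall p, E p -> D p) -> Ck op n D f -> Ck op n E f.
Proof.
move=> ED; elim: n f => [|n IH] f [cf Hf]; (split; first by move=> p /ED; exact: cf) => // j.
by have [g [h1 h2]] := Hf j; exists g; split; [move=> p /ED; exact: h1|exact: IH].
Qed.

Lemma Ck_const (T : UniformSpace) (J : Type) (op : J -> (T -> C) -> T -> C -> Prop) n D (a : C) :
  line_op op -> Ck op n D (fun _ => a).
Proof.
move=> Hop; elim: n a => [|n IH] a; (split; first by move=> p _; exact: continuous_Cconst) => // j.
exists (fun _ => RtoC 0); split=> // p _.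
by have [c [ln [s0 [_ ->]]]] := Hop j p; exact: is_deriv_const.
Qed.

Lemma Ck_plus (T : UniformSpace) (J : Type) (op : J -> (T -> C) -> T -> C -> Prop) n D f g :
  line_op op -> Ck op n D f -> Ck op n D g -> Ck op n D (fun p => f p + g p)%C.
Proof.
move=> Hop; elim: n f g => [|n IH] f g [cf Hf] [cg Hg];
  (split; first by move=> p Dp; apply: continuous_Cplus; [exact: cf|exact: cg]) => // j.
have [f' [h1 h2]] := Hf j; have [g' [k1 k2]] := Hg j.
exists (fun p => f' p + g' p)%C; split; last exact: IH.
move=> p Dp; have {h1} := h1 p Dp; have {k1} := k1 p Dp.
have [c [ln [s0 [_ E]]]] := Hop j p; rewrite !E => *; exact: is_deriv_plus.
Qed.

Lemma Ck_mult (T : UniformSpace) (J : Type) (op : J -> (T -> C) -> T -> C -> Prop) n D f g :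
  line_op op -> Ck op n D f -> Ck op n D g -> Ck op n D (fun p => f p * g p)%C.
Proof.
move=> Hop; elim: n f g => [|n IH] f g Hf Hg;
  (split; first by move=> p Dp; apply: continuous_Cmult; [exact: (proj1 Hf)|exact: (proj1 Hg)]) => // j.
have [f' [h1 h2]] := proj2 Hf j; have [g' [k1 k2]] := proj2 Hg j.
exists (fun p => f' p * g p + f p * g' p)%C; split; last first.
  by apply: Ck_plus => //; apply: IH => //; apply: Ck_S.
move=> p Dp; have {h1} := h1 p Dp; have {k1} := k1 p Dp.
have [c [ln [s0 [e E]]]] := Hop j p; rewrite !E => h1 h2'.
by apply: is_deriv_eqv; [apply: is_deriv_mult; [exact: h2'|exact: h1]|rewrite /= e].
Qed.

Lemma Ck_bigsum (T : UniformSpace) (J : Type) (op : J -> (T -> C) -> T -> C -> Prop) n D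
    (I : Type) (l : seq I) (F : I -> T -> C) :
  line_op op -> (forall i, Ck op n D (F i)) ->
  Ck op n D (fun p => \big[Cplus/RtoC 0]_(i <- l) F i p).
Proof.
move=> Hop HF; elim: l => [|i l IH].
  have -> : (fun p => \big[Cplus/RtoC 0]_(i <- [::]) F i p) = (fun _ => RtoC 0).
    by apply: functional_extensionality => p; rewrite big_nil.
  exact: Ck_const.
have -> : (fun p => \big[Cplus/RtoC 0]_(i0 <- i :: l) F i0 p) =
   (fun p => F i p + \big[Cplus/RtoC 0]_(i <- l) F i p)%C.
  by apply: functional_extensionality => p; rewrite big_cons.
exact: Ck_plus.
Qed.

(** * Composition with analytic functions of several variables *)

(** Coordinates in [l] follow [psi], the others are frozen. Partial lists are the stages of the
    chain rule below; the full enumeration gives continuity into K^I. *)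
Lemma continuous_path c (T : UniformSpace) (I : finType) (l : seq I) (psi : I -> T -> K c) (q0 : pts c I) (p : T) :
  (forall i, continuous (psi i) p) ->
  continuous (fun p => (fun j => if j \in l then psi j p else q0 j) : pts c I) p.
Proof.
move=> H; elim: l => [|i l IH]; first exact: continuous_const.
apply: (continuous_ext (fun p => upd (fun j => if j \in l then psi j p else q0 j) i (psi i p))).
  by move=> x; apply: functional_extensionality => j; rewrite /upd in_cons; case: eqP => [->|].
exact: continuous_upd.
Qed.

Lemma continuous_pts c (T : UniformSpace) (I : finType) (psi : I -> T -> K c) (p : T) :
  (forall i, continuous (psi i) p) -> continuous (fun p => (fun j => psi j p) : pts c I) p.
Proof.
move=> H.
apply: (continuous_ext (fun p' => (fun j => if j \in index_enum I then psi j p' else psi j p) : pts c I)).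
  by move=> x; apply: functional_extensionality => j; rewrite mem_index_enum.
exact: (@continuous_path c T I (index_enum I) psi (fun j => psi j p) p H).
Qed.

(** The base point [Q s] moves together with coordinate i, so the one-variable chain rule does not
    apply. The mean value estimate with the fixed slope [dr (Q s0)] absorbs the motion, by
    continuity of [dr] at [Q s0]. *)
Lemma is_deriv_coordinate_move c (I : finType) (D : pts ComplexVars I -> Prop) (r dr : pts ComplexVars I -> C)
    (i : I) (Q : K c -> pts ComplexVars I) (psi : K c -> C) (s0 : K c) (l : C) :
  open D -> D (Q s0) -> (forall q, D q -> is_pd i r q (dr q)) -> continuous dr (Q s0) ->
  continuous Q s0 -> Q s0 i = psi s0 -> is_deriv psi s0 l ->
  is_deriv (fun s => r (upd (Q s) i (psi s)) - r (upd (Q s) i (psi s0)))%C s0 (dr (Q s0) * l)%C.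
Proof.
move=> oD DQ Hr /continuousP cdr /filterlim_locally cQ E Hpsi.
pose lin s := (dr (Q s0) * (psi s - psi s0))%C.
have D1 : is_deriv lin s0 (dr (Q s0) * l)%C.
  apply: is_deriv_scal; apply: is_deriv_eqv; first by apply: is_deriv_minus; [exact: Hpsi|exact: is_deriv_const].
  by ring.
have D2 : is_deriv (fun s => r (upd (Q s) i (psi s)) - r (upd (Q s) i (psi s0)) - lin s)%C s0 (RtoC 0).
  have cpsi := is_deriv_continuous Hpsi.
  have [phi [cphi _ Hphi]] := is_deriv_slope Hpsi.
  have [d0 [d00 H0]] := Cmod_bound_locally cphi.
  (* [M] bounds the slope of [psi] near [s0]; with e / (2 M) in the mean value estimate the
     remainder is at most e times the increment of [s]. *)
  set M := Cmod (phi s0) + 1 in H0.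
  have M0 : 0 < M by rewrite /M; have := Cmod_ge_0 (phi s0); lra.
  apply/is_derivP => e e0.
  have [d1 [d10 H1]] := proj1 (locallyP _ _) (oD _ DQ).
  have [d2 [d20 H2]] := cdr (e / (2 * M)) (Rdiv_lt_0_compat e (2 * M) e0 ltac:(lra)).
  have dd := Rmin_pos _ _ d10 d20.
  have [d3 [d30 H3]] := proj1 (locally_embP _ _) (cQ (mkposreal _ dd)).
  have [d4 [d40 H4]] := proj1 (continuousP _ _) cpsi _ dd.
  exists (Rmin (Rmin d0 d3) d4); split; first by do! apply: Rmin_pos.
  move=> s Hs.
  have Hs4 := Rlt_le_trans _ _ _ Hs (Rmin_r _ _).
  have {}Hs := Rlt_le_trans _ _ _ Hs (Rmin_l _ _).
  have {}H0 := H0 s (ball_emb (Rlt_le_trans _ _ _ Hs (Rmin_l _ _))).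
  have {}H3 := H3 s (Rlt_le_trans _ _ _ Hs (Rmin_r _ _)).
  have {}H4 := H4 s (ball_emb Hs4).
  have -> : (r (upd (Q s) i (psi s)) - r (upd (Q s) i (psi s0)) - lin s -
      (r (upd (Q s0) i (psi s0)) - r (upd (Q s0) i (psi s0)) - lin s0) - (emb s - emb s0) * 0
      = r (upd (Q s) i (psi s)) - r (upd (Q s) i (psi s0)) - (psi s - psi s0) * dr (Q s0))%C.
    by rewrite /lin; ring.
  apply: Rle_trans.
    apply: (@mvt_estimate ComplexVars (fun z => r (upd (Q s) i z)) (fun z => dr (upd (Q s) i z))
      (psi s0) (psi s) (dr (Q s0)) (e / (2 * M))) => z Hz.
    have b : ball (Q s0) (Rmin d1 d2) (upd (Q s) i z : pts ComplexVars I).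
      apply: ball_upd => //; rewrite E; exact: Rle_lt_trans Hz H4.
    split; first by apply/(@is_pd_upd I ComplexVars); apply: Hr; apply: H1; apply: ball_le b; exact: Rmin_l.
    by left; apply: H2; apply: ball_le b; exact: Rmin_r.
  rewrite /= Hphi Cmod_mult.
  have -> : 2 * (e / (2 * M)) * (Cmod (emb s - emb s0) * Cmod (phi s)) =
     (e * Cmod (emb s - emb s0)) * (Cmod (phi s) / M) by field; lra.
  rewrite -[X in _ <= X]Rmult_1_r; apply: Rmult_le_compat_l.
    by apply: Rmult_le_pos; [lra|exact: Cmod_ge_0].
  by apply/Rle_div_l; lra.
apply: (@is_deriv_ext_loc c (fun s => r (upd (Q s) i (psi s)) - r (upd (Q s) i (psi s0)) - lin s + lin s)%C).
  by apply: filter_forall => s; ring.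
by apply: is_deriv_eqv; [exact: is_deriv_plus D2 D1|ring].
Qed.

(** The coordinates are moved one after the other along an enumeration of [I]; the increments of [r]
    telescope, and each has the derivative just computed. *)
Lemma is_deriv_comp_pts c (I : finType) (D : pts ComplexVars I -> Prop) (r : pts ComplexVars I -> C)
    (dr : I -> pts ComplexVars I -> C) (psi : I -> K c -> C) (s0 : K c) (l : I -> C) :
  open D -> D (fun i => psi i s0) ->
  (forall i q, D q -> is_pd i r q (dr i q) /\ continuous (dr i) q) ->
  (forall i, is_deriv (psi i) s0 (l i)) ->
  is_deriv (fun s => r (fun i => psi i s)) s0
    (\big[Cplus/RtoC 0]_(i : I) (dr i (fun i => psi i s0) * l i)%C).
Proof.
move=> oD Dp Hr Hpsi.
pose q0 : pts ComplexVars I := fun i => psi i s0.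
pose path (ll : seq I) (s : K c) : pts ComplexVars I := fun j => if j \in ll then psi j s else q0 j.
have path0 ll : path ll s0 = q0.
  by apply: functional_extensionality => j; rewrite /path; case: ifP.
have cpath ll : continuous (path ll) s0.
  by apply: (@continuous_path ComplexVars) => i; exact: is_deriv_continuous (Hpsi i).
have H ll : uniq ll -> is_deriv (fun s => r (path ll s)) s0
    (\big[Cplus/RtoC 0]_(i <- ll) (dr i q0 * l i)%C).
  elim: ll => [_|i ll IH /= /andP[ill /IH{}IH]].
    by rewrite big_nil; exact: (@is_deriv_const c (r q0) s0).
  rewrite big_cons Cplus_comm.
  apply: (@is_deriv_ext_loc c (fun s => r (path ll s) +
      (r (upd (path ll s) i (psi i s)) - r (upd (path ll s) i (psi i s0))))%C).
    apply: filter_forall => s.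
    have -> : upd (path ll s) i (psi i s0) = path ll s.
      by apply: functional_extensionality => j; rewrite /upd /path; case: eqP => // ->; rewrite (negbTE ill).
    have -> : upd (path ll s) i (psi i s) = path (i :: ll) s.
      by apply: functional_extensionality => j; rewrite /upd /path in_cons; case: eqP => // ->.
    by move: (r _) (r _) => A B; ring.
  apply: is_deriv_plus => //.
  rewrite -(path0 ll); apply: (@is_deriv_coordinate_move c I D) => //.
  - by rewrite path0.
  - by move=> q /Hr-/(_ i)[].
  - by rewrite path0; case: (Hr i _ Dp).
  - by rewrite path0.
have := H _ (index_enum_uniq I).
apply: is_deriv_ext_loc; apply: filter_forall => s; congr r.
by apply: functional_extensionality => j; rewrite /path mem_index_enum.
Qed.

Lemma analytic_partials (I : finType) (D : pts ComplexVars I -> Prop) (r : pts ComplexVars I -> C) :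
  open D -> analytic D r -> exists dr : I -> pts ComplexVars I -> C,
   (forall i q, D q -> is_pd i r q (dr i q) /\ continuous (dr i) q) /\ forall i, analytic D (dr i).
Proof.
move=> oD Hr; have [cr /= H] := Hr.
exists (fun k => proj1_sig (constructive_indefinite_description _ (H k))); split=> [k q Dq|k];
  have [h1 [h2 _]] := proj2_sig (constructive_indefinite_description _ (H k)).
  by split; [exact: h1|exact: h2].
exact: (analytic_partial oD Hr h1).
Qed.

(** The chain rule replaces [r] by its partials, which are again analytic; hence the induction on n
    is for all [r] at once. *)
Lemma Ck_comp (T : UniformSpace) (J : Type) (op : J -> (T -> C) -> T -> C -> Prop) n E
    (I : finType) (D : pts ComplexVars I -> Prop) (r : pts ComplexVars I -> C) (psi : I -> T -> C) :
  line_op op -> open D -> analytic D r -> (forall p, E p -> D (fun i => psi i p)) ->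
  (forall i, Ck op n E (psi i)) -> Ck op n E (fun p => r (fun i => psi i p)).
Proof.
move=> Hop oD Hr ED; elim: n r Hr => [|n IH] r Hr Hpsi.
all: have cc p : E p -> continuous (fun p => r (fun i => psi i p)) p
  by move=> Ep; apply: (continuous_comp (fun p => (fun i => psi i p) : pts ComplexVars I) r);
  [apply: (@continuous_pts ComplexVars) => i; exact: (proj1 (Hpsi i))|case: Hr => h _; apply: h; exact: ED].
  by split.
split=> // j.
have [dr [h1 h2]] := analytic_partials oD Hr.
have H i := proj2 (Hpsi i) j.
have [dpsi Hd] : exists dpsi : I -> T -> C, forall i,
    (forall p, E p -> op j (psi i) p (dpsi i p)) /\ Ck op n E (dpsi i).
  exists (fun i => proj1_sig (constructive_indefinite_description _ (H i))) => i.
  exact: (proj2_sig (constructive_indefinite_description _ (H i))).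
exists (fun p => \big[Cplus/RtoC 0]_(i : I) (dr i (fun i => psi i p) * dpsi i p)%C); split; last first.
  apply: Ck_bigsum => // i; apply: Ck_mult => //; last exact: (proj2 (Hd i)).
  by apply: IH => // k; apply: Ck_S.
move=> p Ep.
have Hi i : op j (psi i) p (dpsi i p) by apply: (proj1 (Hd i)).
have [c [ln [s0 [e Eq]]]] := Hop j p.
apply/Eq; rewrite -e in Ep *.
apply: (@is_deriv_comp_pts c I D r dr (fun i s => psi i (ln s))) => //; first exact: ED.
by move=> i; apply/Eq; rewrite e.
Qed.

(** * Finite sums of complex numbers *)

HB.instance Definition _ := Monoid.isComLaw.Build C (RtoC 0) Cplus Cplus_assoc Cplus_comm Cplus_0_l.
HB.instance Definition _ := Monoid.isMulLaw.Build C (RtoC 0) Cmult Cmult_0_l Cmult_0_r.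
HB.instance Definition _ := Monoid.isAddLaw.Build C Cmult Cplus Cmult_plus_distr_r Cmult_plus_distr_l.

Lemma continuous_bigsum (T : UniformSpace) (I : Type) (l : seq I) (F : I -> T -> C) (p : T) :
  (forall i, continuous (F i) p) -> continuous (fun q => \big[Cplus/RtoC 0]_(i <- l) F i q) p.
Proof.
move=> HF; elim: l => [|i l IH].
  apply: (continuous_Ceq (f := fun _ => RtoC 0)); last exact: continuous_Cconst.
  by move=> q; rewrite big_nil.
apply: (continuous_Ceq (f := (fun q => F i q + \big[Cplus/RtoC 0]_(i <- l) F i q)%C)).
  by move=> q; rewrite big_cons.
exact: continuous_Cplus.
Qed.

Lemma is_deriv_bigsum c (I : Type) (l : seq I) (F : I -> K c -> C) (x : K c) (d : I -> C) :
  (forall i, is_deriv (F i) x (d i)) ->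
  is_deriv (fun q => \big[Cplus/RtoC 0]_(i <- l) F i q) x (\big[Cplus/RtoC 0]_(i <- l) d i).
Proof.
move=> HF; elim: l => [|i l IH].
  rewrite big_nil; apply: (@is_deriv_ext_loc c (fun _ => RtoC 0)); last exact: is_deriv_const.
  by apply: filter_forall => q; rewrite big_nil.
rewrite big_cons.
apply: (@is_deriv_ext_loc c (fun q => F i q + \big[Cplus/RtoC 0]_(i <- l) F i q)%C); last exact: is_deriv_plus.
by apply: filter_forall => q; rewrite big_cons.
Qed.

(** * Integrals along piecewise C^1 curves *)

(** Replaces the total derivative of [gam], meaningless at corners, by the derivatives of C^1
    extensions of the pieces. The last two clauses are the uses: a contour integral is a sum over
    pieces, and end point values telescope. *)
Lemma contour_pieces (a b : R) (gam : R -> C) : piecewise_C1 a b gam ->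
  exists (n : nat) (sg : nat -> R) (g dg : nat -> R -> C),
  [/\ forall i, (i < n)%N -> sg i <= sg i.+1,
      forall i s, (i < n)%N -> @is_deriv RealVars (g i) s (dg i s) /\ continuous (dg i) s,
      forall i s, (i < n)%N -> sg i <= s <= sg i.+1 -> gam s = g i s /\ a <= s <= b,
      forall f : C -> C, (forall s, a <= s <= b -> continuous (f : C_UniformSpace -> C) (gam s)) ->
        is_RIntC (fun s => f (gam s) * @deriv RealVars gam s)%C a b
          (\big[Cplus/RtoC 0]_(i < n) RIntC (fun s => f (g i s) * dg i s)%C (sg i) (sg i.+1)) &
      forall G : C -> C,
        \big[Cplus/RtoC 0]_(i < n) (G (g i (sg i.+1)) - G (g i (sg i)))%C = (G (gam b) - G (gam a))%C].
Proof.
move=> [n [sg [s0 [sn H]]]].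
have [g Hg] : exists g : nat -> R -> C, forall i, (i < n)%N -> C1_curve (g i) /\
    forall s, sg i <= s <= sg i.+1 -> gam s = g i s.
  have H' i : exists g : R -> C, (i < n)%N -> C1_curve g /\ forall s, sg i <= s <= sg i.+1 -> gam s = g s.
    case: (boolP (i < n)%N) => [/H[_ [g Hg]]|_]; last by exists (fun _ => RtoC 0).
    by exists g.
  exists (fun i => proj1_sig (constructive_indefinite_description _ (H' i))) => i.
  exact: (proj2_sig (constructive_indefinite_description _ (H' i))).
have [dg Hdg] : exists dg : nat -> R -> C, forall i, (i < n)%N -> forall s,
    @is_deriv RealVars (g i) s (dg i s) /\ continuous (dg i) s.
  have H' i : exists dg : R -> C, (i < n)%N -> forall s, @is_deriv RealVars (g i) s (dg s) /\ continuous dg s.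
    case: (boolP (i < n)%N) => [/Hg[[dg Hdg] _]|_]; last by exists (fun _ => RtoC 0).
    by exists dg.
  exists (fun i => proj1_sig (constructive_indefinite_description _ (H' i))) => i.
  exact: (proj2_sig (constructive_indefinite_description _ (H' i))).
have lt i : (i < n)%N -> sg i < sg i.+1 by case/H.
have mono i j : (i <= j)%N -> (j <= n)%N -> sg i <= sg j.
  elim: j => [|j IH]; first by rewrite leqn0 => /eqP -> _; lra.
  rewrite leq_eqVlt => /orP[/eqP -> _|]; first lra.
  rewrite ltnS => ij jn; have := IH ij (ltnW jn); have := lt j jn; lra.
have inab i s : (i < n)%N -> sg i <= s <= sg i.+1 -> a <= s <= b.
  move=> ni hs; have := mono 0%N i (leq0n _) (ltnW ni); have := mono i.+1 n ni (leqnn _).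
  rewrite s0 sn; lra.
exists n, sg, g, dg; split=> //.
- by move=> i /lt; lra.
- by move=> i s ni; apply: Hdg.
- by move=> i s ni hs; split; [apply: (proj2 (Hg i ni))|apply: inab hs].
- move=> f cf.
  have P m : (m <= n)%N -> is_RIntC (fun s => f (gam s) * @deriv RealVars gam s)%C (sg 0%N) (sg m)
       (\big[Cplus/RtoC 0]_(i < m) RIntC (fun s => f (g i s) * dg i s)%C (sg i) (sg i.+1)).
    elim: m => [_|m IH mn]; first by rewrite big_ord0; apply: (@is_RInt_point C_R_NormedModule).
    rewrite big_ord_recr; apply: (@is_RInt_Chasles C_R_NormedModule _ _ (sg m)); first exact: IH (ltnW mn).
    have sm := Rlt_le _ _ (lt m mn).
    (* Equality is required only inside the open piece, where [gam] agrees with [g m] near each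
       point; default values of [deriv] at the ends do not enter. *)
    apply: (@is_RInt_ext C_R_NormedModule (fun s => f (g m s) * dg m s)%C).
      move=> s; rewrite Rmin_left // Rmax_right // => hs.
      rewrite (proj2 (Hg m mn) s ltac:(lra)); congr (_ * _)%C; apply/esym/is_deriv_deriv.
      apply: (@is_deriv_ext_loc RealVars (g m)); last by case: (Hdg m mn s).
      apply/locallyP; exists (Rmin (s - sg m) (sg m.+1 - s)); split; first by apply: Rmin_pos; lra.
      move=> y hy; apply/esym/(proj2 (Hg m mn)).
      have /Rabs_def2 : Rabs (y - s) < Rmin (s - sg m) (sg m.+1 - s) by exact: hy.
      have := Rmin_l (s - sg m) (sg m.+1 - s); have := Rmin_r (s - sg m) (sg m.+1 - s); lra.
    apply: RIntC_correct; apply: ex_RIntC_continuous => // s hs.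
    have [d1 c1] := Hdg m mn s.
    apply: continuous_Cmult => //; apply: (continuous_comp (g m) f).
      exact: is_deriv_continuous d1.
    by rewrite -(proj2 (Hg m mn) s hs); apply: cf; apply: inab hs.
  by have := P n (leqnn n); rewrite s0 sn.
- move=> G.
  have P m : (m <= n)%N -> \big[Cplus/RtoC 0]_(i < m) (G (g i (sg i.+1)) - G (g i (sg i)))%C =
       (G (gam (sg m)) - G (gam (sg 0%N)))%C.
    elim: m => [_|m IH mn]; first by rewrite big_ord0; ring.
    rewrite big_ord_recr /= (IH (ltnW mn)).
    have sm := Rlt_le _ _ (lt m mn).
    rewrite -(proj2 (Hg m mn) (sg m)); last lra.
    by rewrite -(proj2 (Hg m mn) (sg m.+1)); [ring|lra].
  by have := P n (leqnn n); rewrite s0 sn.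
Qed.

Lemma contour_int_plus (a b : R) (gam : R -> C) (f h : C -> C) : piecewise_C1 a b gam ->
  (forall s, a <= s <= b -> continuous (f : C_UniformSpace -> C) (gam s)) ->
  (forall s, a <= s <= b -> continuous (h : C_UniformSpace -> C) (gam s)) ->
  contour_int a b gam (fun z => f z + h z)%C = (contour_int a b gam f + contour_int a b gam h)%C.
Proof.
move=> /contour_pieces[n [sg [g [dg [_ _ _ H _]]]]] /H If /H Ih.
rewrite /contour_int (is_RIntC_unique If) (is_RIntC_unique Ih).
apply: is_RIntC_unique; apply: (@is_RInt_ext C_R_NormedModule); last exact: (is_RIntC_plus If Ih).
by move=> s _ /=; ring.
Qed.

Lemma contour_int_scal (a b : R) (gam : R -> C) (k : C) (f : C -> C) : piecewise_C1 a b gam ->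
  (forall s, a <= s <= b -> continuous (f : C_UniformSpace -> C) (gam s)) ->
  contour_int a b gam (fun z => k * f z)%C = (k * contour_int a b gam f)%C.
Proof.
move=> /contour_pieces[n [sg [g [dg [_ _ _ H _]]]]] /H If.
rewrite /contour_int (is_RIntC_unique If).
apply: is_RIntC_unique; apply: (@is_RInt_ext C_R_NormedModule); last exact: (@is_RIntC_scal _ _ _ k _ If).
by move=> s _ /=; ring.
Qed.

Lemma contour_int_eq (a b : R) (gam : R -> C) (f h : C -> C) : a <= b ->
  (forall s, a <= s <= b -> f (gam s) = h (gam s)) ->
  contour_int a b gam f = contour_int a b gam h.
Proof.
move=> ab H; apply: (@RInt_ext C_R_CompleteNormedModule) => s.
by rewrite Rmin_left // Rmax_right // => hs; rewrite H //; lra.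
Qed.

Lemma contour_int0 (a b : R) (gam : R -> C) : piecewise_C1 a b gam ->
  contour_int a b gam (fun _ => RtoC 0) = RtoC 0.
Proof.
move=> hg.
have := @contour_int_scal a b gam (RtoC 0) (fun _ => RtoC 0) hg (fun s _ => @continuous_Cconst C_UniformSpace (RtoC 0) (gam s)).
have -> : (fun _ : C => 0 * 0)%C = (fun _ => RtoC 0) by apply: functional_extensionality => z; ring.
by move=> ->; ring.
Qed.

Lemma contour_int_bigsum (a b : R) (gam : R -> C) (I : Type) (l : seq I) (f : I -> C -> C) :
  piecewise_C1 a b gam ->
  (forall i s, a <= s <= b -> continuous (f i : C_UniformSpace -> C) (gam s)) ->
  contour_int a b gam (fun z => \big[Cplus/RtoC 0]_(i <- l) f i z) =
  \big[Cplus/RtoC 0]_(i <- l) contour_int a b gam (f i).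
Proof.
move=> hg cf; elim: l => [|i l IH].
  rewrite big_nil -[RHS](contour_int0 hg); congr (contour_int _ _ _ _).
  by apply: functional_extensionality => z; rewrite big_nil.
rewrite big_cons -IH -contour_int_plus //; last first.
- by move=> s hs; apply: (@continuous_bigsum C_UniformSpace) => j; apply: cf.
- by move=> s hs; apply: cf.
by congr (contour_int _ _ _ _); apply: functional_extensionality => z; rewrite big_cons.
Qed.

Lemma contour_int_derivative (a b : R) (gam : R -> C) (G dG : C -> C) :
  closed_curve a b gam ->
  (forall s, a <= s <= b -> @is_deriv ComplexVars G (gam s) (dG (gam s)) /\
     continuous (dG : C_UniformSpace -> C) (gam s)) ->
  contour_int a b gam dG = RtoC 0.
Proof.
move=> [_ [/contour_pieces[n [sg [g [dg [le Hd Hg H tel]]]]] closed]] HG.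
rewrite /contour_int (is_RIntC_unique (H _ (fun s hs => proj2 (HG s hs)))).
transitivity (G (gam b) - G (gam a))%C; last by rewrite closed; ring.
rewrite -tel; apply: eq_bigr => -[i ni] _ /=.
apply: is_RIntC_unique; apply: (is_RIntC_deriv (f := fun s => G (g i s))); first exact: le.
  move=> s hs; have [d1 _] := Hd i s ni; have [E hab] := Hg i s ni hs.
  apply: is_deriv_eqv.
    apply: (@is_deriv_comp RealVars (g i) G); first exact: d1.
    by rewrite -E; exact: (proj1 (HG s hab)).
  by rewrite E; ring.
move=> s hs; have [d1 c1] := Hd i s ni; have [E hab] := Hg i s ni hs.
apply: continuous_Cmult => //; apply: (continuous_comp (g i) dG).
  exact: is_deriv_continuous d1.
by rewrite -E; exact: (proj2 (HG s hab)).
Qed.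

Lemma continuous_pair_section (T : UniformSpace) (F : prod_UniformSpace T C_UniformSpace -> C) (p : T) (z : C) :
  continuous F (p, z) -> continuous (fun w : C_UniformSpace => F (p, w)) z.
Proof.
move=> cF; apply: (continuous_comp (fun w : C_UniformSpace => (p, w) : prod_UniformSpace T C_UniformSpace) F) => //.
apply/filterlim_locally => e; exists e => y hy; split=> //; exact: ball_center.
Qed.

Lemma continuous_along (S T : UniformSpace) (F : prod_UniformSpace T C_UniformSpace -> C)
    (u : S -> T) (g dg : R -> C) (p : S) (s : R) :
  continuous u p -> continuous g s -> continuous dg s -> continuous F (u p, g s) ->
  continuous (fun q : prod_UniformSpace S R_UniformSpace => F (u q.1, g q.2) * dg q.2)%C (p, s).
Proof.
move=> cu cg cdg cF; apply: continuous_Cmult; last exact: continuous_sndC.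
apply: (continuous_comp (fun q : prod_UniformSpace S R_UniformSpace =>
  (u q.1, g q.2) : prod_UniformSpace T C_UniformSpace) F) => //.
apply/filterlim_locally => e.
have [d1 [d10 H1]] := proj1 (locallyP _ _) (proj1 (filterlim_locally _ _) cu e).
have [d2 [d20 H2]] := proj1 (locallyP _ _) (proj1 (filterlim_locally _ _) cg e).
apply/locallyP; exists (Rmin d1 d2); split; first exact: Rmin_pos.
move=> q [h1 h2]; split => /=.
  by apply: H1; apply: ball_le h1; exact: Rmin_l.
by apply: H2; apply: ball_le h2; exact: Rmin_r.
Qed.

Lemma continuous_contour_int (T : UniformSpace) (a b : R) (gam : R -> C) (U : T -> Prop) (V : C -> Prop)
    (F : prod_UniformSpace T C_UniformSpace -> C) (p0 : T) :
  piecewise_C1 a b gam -> nbhd_of_curve a b gam V -> open U -> U p0 ->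
  (forall P, U P.1 /\ V P.2 -> continuous F P) ->
  continuous (fun t => contour_int a b gam (fun z => F (t, z))) p0.
Proof.
move=> /contour_pieces[n [sg [g [dg [le Hd Hg H _]]]]] [oV gV] oU Up0 cF.
apply: (continuous_ext_loc _ (fun t =>
   \big[Cplus/RtoC 0]_(i < n) RIntC (fun s => F (t, g i s) * dg i s)%C (sg i) (sg i.+1))).
  apply: filter_imp (oU _ Up0) => t Ut; apply/esym/is_RIntC_unique.
  apply: (H (fun z => F (t, z))) => s hs; apply: continuous_pair_section; apply: cF; split=> //; exact: gV.
apply: continuous_bigsum => -[i ni] /=.
have cc (t : T) s : U t -> sg i <= s <= sg i.+1 ->
    continuous (fun q : prod_UniformSpace T R_UniformSpace => F (q.1, g i q.2) * dg i q.2)%C (t, s).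
  move=> Ut hs; have [d1 c1] := Hd i s ni; have [E hab] := Hg i s ni hs.
  apply: (@continuous_along T T F (fun t => t)) => //.
    exact: is_deriv_continuous d1.
  by apply: cF; split=> //=; rewrite -E; apply: gV.
apply: (@continuous_RIntC_param T (fun t s => F (t, g i s) * dg i s)%C); first exact: le.
  apply: filter_imp (oU _ Up0) => t Ut s hs.
  by apply: (continuous_section (H := (fun t s => F (t, g i s) * dg i s)%C)); apply: cc.
by move=> s hs; apply: cc.
Qed.

(** On each C^1 piece this is differentiation under the integral along a coordinate line. The
    decomposition into pieces is valid for t in [U], so it is used as a local identity. *)
Lemma is_pd_contour_int c (I : finType) (i : I) (a b : R) (gam : R -> C) (U : pts c I -> Prop) (V : C -> Prop)
    (F G : jpts c I -> C) (p0 : pts c I) :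
  piecewise_C1 a b gam -> nbhd_of_curve a b gam V -> open U -> U p0 ->
  (forall P, U P.1 /\ V P.2 -> [/\ continuous F P, continuous G P & is_jpd (inl i) F P (G P)]) ->
  is_pd i (fun t => contour_int a b gam (fun z => F (t, z))) p0 (contour_int a b gam (fun z => G (p0, z))).
Proof.
move=> /contour_pieces[n [sg [g [dg [le Hd Hg H _]]]]] [oV gV] oU Up0 HF.
have S (f : jpts c I -> C) t : U t -> (forall P, U P.1 /\ V P.2 -> continuous f P) ->
   contour_int a b gam (fun z => f (t, z)) =
   \big[Cplus/RtoC 0]_(i < n) RIntC (fun s => f (t, g i s) * dg i s)%C (sg i) (sg i.+1).
  move=> Ut cf; apply: is_RIntC_unique; apply: (H (fun z => f (t, z))) => s hs.
  by apply: continuous_pair_section; apply: cf; split=> //; exact: gV.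
apply: (@is_pd_ext_loc I c i (fun t =>
   \big[Cplus/RtoC 0]_(i < n) RIntC (fun s => F (t, g i s) * dg i s)%C (sg i) (sg i.+1))).
  by apply: filter_imp (oU _ Up0) => t Ut; rewrite S // => P /HF[].
rewrite S //; last by move=> P /HF[].
apply: is_deriv_bigsum => -[j nj] /=.
have lU : locally (p0 i) (fun w : K c => U (upd p0 i w)).
  by have := oU _ Up0; rewrite -{1}(upd_id p0 i) => h; exact: (continuous_line h).
pose h (f : jpts c I -> C) (w : K c) (s : R) := (f (upd p0 i w, g j s) * dg j s)%C.
have cc (f : jpts c I -> C) (w : K c) s : (forall P, U P.1 /\ V P.2 -> continuous f P) -> U (upd p0 i w) -> sg j <= s <= sg j.+1 ->
    continuous (fun q : prod_UniformSpace (K c) R_UniformSpace => h f q.1 q.2) (w, s).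
  move=> cf Ut hs; have [d1 c1] := Hd j s nj; have [E hab] := Hg j s nj hs.
  apply: (@continuous_along (K c) (pts c I) f (fun w => upd p0 i w)) => //.
  - exact: continuous_line.
  - exact: is_deriv_continuous d1.
  by apply: cf; split=> //=; rewrite -E; apply: gV.
have -> : RIntC (fun s => G (p0, g j s) * dg j s)%C (sg j) (sg j.+1) = RIntC (h G (p0 i)) (sg j) (sg j.+1).
  by rewrite /h upd_id.
apply: (@is_deriv_RIntC_param c (h F) (h G)); first exact: le.
  apply: filter_imp lU => w Uw s hs; split.
    by apply: (continuous_section (H := h F)); apply: cc => // P /HF[].
  have [E hab] := Hg j s nj hs.
  have [] := HF (upd p0 i w, g j s); first by split=> //=; rewrite -E; apply: gV.
  move=> _ _ /is_pd_upd D1.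
  apply: is_deriv_eqv; first by apply: is_deriv_mult; [exact: D1|exact: is_deriv_const].
  by rewrite /h; ring.
move=> s hs; apply: cc => //; first by move=> P /HF[].
by rewrite upd_id.
Qed.

Lemma Ck_contour_int c (I : finType) n (a b : R) (gam : R -> C) (U : pts c I -> Prop) (V : C -> Prop)
    (F : jpts c I -> C) :
  piecewise_C1 a b gam -> nbhd_of_curve a b gam V -> open U ->
  Ck (@is_jpd c I) n (fun P => U P.1 /\ V P.2) F ->
  Ck (@is_pd c I) n U (fun t => contour_int a b gam (fun z => F (t, z))).
Proof.
move=> hg hV oU; elim: n F => [|n IH] F [cF HF];
  (split; first by move=> t Ut; apply: continuous_contour_int cF) => // i.
have [G [h1 h2]] := HF (inl i).
exists (fun t => contour_int a b gam (fun z => G (t, z))); split; last exact: IH.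
move=> t Ut; apply: is_pd_contour_int hV oU Ut _ => // P HP.
by split; [exact: cF|case: (n) h2 => [|m] [cG _]; exact: cG|exact: h1].
Qed.

(** * The linear equations from a potential *)

Lemma Ck_ext_open c (I : finType) n (D : pts c I -> Prop) (f g : pts c I -> C) :
  open D -> (forall p, D p -> f p = g p) -> Ck (@is_pd c I) n D f -> Ck (@is_pd c I) n D g.
Proof.
move=> oD E.
have lE p : D p -> locally p (fun q => f q = g q) by move=> /oD; apply: filter_imp.
case: n => [|n] [cf Hf];
  (split; first by move=> p Dp; apply: (continuous_ext_loc _ f); [exact: lE|exact: cf]) => // j.
have [h [h1 h2]] := Hf j.
by exists h; split=> // p Dp; apply: is_pd_ext_loc (lE p Dp) _; apply: h1.
Qed.

(** [Ck] provides derivatives existentially; uniqueness identifies them on [D] with the total [pd],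
    so iterated [pd] can be used in formulas. *)
Lemma Ck_pd c (I : finType) n (D : pts c I -> Prop) (f : pts c I -> C) (i : I) :
  open D -> Ck (@is_pd c I) n.+1 D f ->
  (forall p, D p -> is_pd i f p (pd i f p)) /\ Ck (@is_pd c I) n D (pd i f).
Proof.
move=> oD [_ Hf]; have [g [h1 h2]] := Hf i; split.
  by move=> p /h1 h; rewrite (is_pd_pd h).
by apply: Ck_ext_open h2 => // p /h1 /is_pd_pd.
Qed.

Lemma pd_swap c (I : finType) (D : pts c I -> Prop) (f : pts c I -> C) (i j : I) (p : pts c I) :
  open D -> Ck (@is_pd c I) 2 D f -> D p -> pd i (pd j f) p = pd j (pd i f) p.
Proof.
move=> oD Hf Dp; have [->//|ij] := eqVneq i j.
have [i1 i2] := Ck_pd i oD Hf; have [j1 j2] := Ck_pd j oD Hf.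
have [ij1 ij2] := Ck_pd j oD i2; have [ji1 ji2] := Ck_pd i oD j2.
apply/esym/(schwarz oD Dp ij (fi := pd i f) (fj := pd j f)).
- by move=> q Dq; split; [exact: i1|exact: ij1].
- by move=> q Dq; split; [exact: j1|exact: ji1].
- exact: (proj1 ij2).
- exact: (proj1 ji2).
Qed.

(* Writing D_k for [Dt u k], the commutator of D_k with the x^q-derivative only
   involves the second derivatives of u, hence is symmetric in k and q. *)
Lemma solves_linear_of_potential c (N : nat) (U : pts c (coords N) -> Prop)
    (u : 'I_N -> pts c (coords N) -> C) (f psi : pts c (coords N) -> C) :
  open U -> (forall p, Ck (@is_pd c (coords N)) 2 U (u p)) ->
  Ck (@is_pd c (coords N)) 2 U f -> Ck (@is_pd c (coords N)) 2 U psi ->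
  (forall k t, U t -> Dt u k f t = pd (dx k) psi t) ->
  solves_linear U u f.
Proof.
move=> oU Hu Hf Hpsi E; split=> // k q t Ut.
(* Obtained by computing the x^q-derivative of D_k f twice: by the product rule ([D1]) and through
   the potential ([D2]). Both terms on the right are symmetric in k and q. *)
have A k' q' : Dt u k' (pd (dx q') f) t = (pd (dx q') (pd (dx k') psi) t
    - Csum (fun p => pd (dx q') (pd (dx k') (u p)) t * pd (dx p) f t))%C.
  have F1 i := Ck_pd i oU Hf.
  have F2 i j := proj1 (Ck_pd j oU (proj2 (F1 i))).
  have U1 p i := Ck_pd i oU (Hu p).
  have U2 p i j := proj1 (Ck_pd j oU (proj2 (U1 p i))).
  have D1 : is_pd (dx q') (Dt u k' f) t (pd (dx q') (pd (dt k') f) t +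
      Csum (fun p => pd (dx q') (pd (dx k') (u p)) t * pd (dx p) f t
                     + pd (dx k') (u p) t * pd (dx q') (pd (dx p) f) t))%C.
    apply: is_deriv_plus; first exact: F2.
    apply: is_deriv_bigsum => p; apply: is_deriv_eqv.
      by apply: is_deriv_mult; [exact: U2|exact: F2].
    by rewrite /= upd_id.
  have D2 : is_pd (dx q') (Dt u k' f) t (pd (dx q') (pd (dx k') psi) t).
    apply: (@is_pd_ext_loc _ c _ (pd (dx k') psi)).
      by apply: filter_imp (oU _ Ut) => y Uy; rewrite E.
    exact: (proj1 (Ck_pd _ oU (proj2 (Ck_pd _ oU Hpsi)))).
  rewrite -(is_deriv_unique D1 D2) /Csum big_split /= /Dt /Csum (pd_swap (dt k') (dx q') oU Hf Ut).
  under [in LHS]eq_bigr => p _ do rewrite (pd_swap (dx p) (dx q') oU Hf Ut).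
  have cancel (x y z : C) : (x + z = x + (y + z) - y)%C by ring.
  exact: cancel.
rewrite !A (pd_swap (dx q) (dx k) oU Hpsi Ut) /Csum.
under eq_bigr => p _ do rewrite (pd_swap (dx q) (dx k) oU (Hu p) Ut).
have cancel (x y : C) : (x - y - (x - y) = RtoC 0)%C by ring.
exact: cancel.
Qed.

(** * Wave functions *)

Lemma Ck_lambda c (I : finType) n (D : jpts c I -> Prop) : Ck (@is_jpd c I) n D (fun P => P.2).
Proof.
have c2 P : D P -> continuous (fun P : jpts c I => P.2 : C) P.
  by move=> _; apply: (@continuous_sndC (pts c I) C_UniformSpace (fun z => z)); apply: continuous_Cid.
case: n => [|n]; (split; first exact: c2) => // -[i|b].
  exists (fun _ => RtoC 0); split; last by apply: Ck_const; apply: line_op_jpd.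
  move=> P _; exact: is_deriv_const.
exists (fun _ => if b then Ci else RtoC 1); split; last by apply: Ck_const; apply: line_op_jpd.
move=> [p [x y]] _; case: b.
  apply: (@is_deriv_ext_loc RealVars (fun s => RtoC x + Ci * RtoC s)%C).
    by apply: filter_forall => s; rewrite /Ci /RtoC /Cplus /Cmult /=; congr pair; ring.
  apply: is_deriv_eqv.
    by apply: is_deriv_plus; [exact: is_deriv_const|apply: is_deriv_scal; exact: (@is_deriv_emb RealVars)].
  ring.
apply: (@is_deriv_ext_loc RealVars (fun s => RtoC s + Ci * RtoC y)%C).
  by apply: filter_forall => s; rewrite /Ci /RtoC /Cplus /Cmult /=; congr pair; ring.
apply: is_deriv_eqv.
  by apply: is_deriv_plus; [exact: (@is_deriv_emb RealVars)|exact: is_deriv_const].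
ring.
Qed.

Lemma regular_for_Ck1 c (T : UniformSpace) (J : Type) (op : J -> (T -> C) -> T -> C -> Prop) D f :
  regular_for c op D f -> Ck op 1 D f.
Proof. by case: c => // H; exact: H. Qed.

Lemma regular_contour_int c (I : finType) (a b : R) (gam : R -> C) (U : pts c I -> Prop) (V : C -> Prop)
    (F : jpts c I -> C) :
  piecewise_C1 a b gam -> nbhd_of_curve a b gam V -> open U ->
  regular_for c (@is_jpd c I) (fun P => U P.1 /\ V P.2) F ->
  regular U (fun t => contour_int a b gam (fun z => F (t, z))).
Proof.
move=> hg hV oU; rewrite /regular.
case: c U F oU => U F oU HF => [n|]; apply: (Ck_contour_int hg hV oU); exact: HF.
Qed.

Lemma regular_for_lambda_mult c (I : finType) (D : jpts c I -> Prop) (F : jpts c I -> C) :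
  regular_for c (@is_jpd c I) D F -> regular_for c (@is_jpd c I) D (fun P => P.2 * F P)%C.
Proof.
have M n : Ck (@is_jpd c I) n D F -> Ck (@is_jpd c I) n D (fun P => P.2 * F P)%C.
  by apply: Ck_mult; [exact: line_op_jpd|exact: Ck_lambda].
case: (c) D F M => D F M H; last exact: M.
by move=> n; apply: M.
Qed.

(* The real derivative along Re lambda represents the complex derivative, and
   it is continuous by regularity. *)
Lemma regular_hol_lambda_derivative c (I : finType) (D : jpts c I -> Prop) (F : jpts c I -> C) :
  regular_hol D F -> exists L : jpts c I -> C,
    forall P, D P -> continuous L P /\ @is_deriv ComplexVars (fun z => F (P.1, z)) P.2 (L P).
Proof.
move=> [/regular_for_Ck1[_ HF] Hc]; have [L [h1 [h2 _]]] := HF (inr false).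
exists L => P DP; split; first exact: h2.
have [l Hl] := Hc P DP.
have D1 := h1 P DP.
have D2 : is_jpd (inr false) F P (1 * l)%C.
  apply: (@is_deriv_affine ComplexVars (fun z => F (P.1, z)) l (fun s => (s, Im P.2)) (Ci * Im P.2)%C (RtoC 1)).
    by move=> s; rewrite /Ci /RtoC /Cplus /Cmult /=; congr pair; ring.
  by case: (P) Hl => p [x y].
have -> : L P = l; last exact: Hl.
by rewrite (@is_deriv_unique RealVars _ _ _ _ D1 D2); ring.
Qed.

Lemma wave_function_solves_linear c (N : nat) (U : pts c (coords N) -> Prop)
    (u0 : pts c (coords N) -> C) (u : 'I_N -> pts c (coords N) -> C) (a b : R) (gam : R -> C)
    (Psi : jpts c (coords N) -> C) :
  open U -> (forall p, regular U (u p)) -> closed_curve a b gam ->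
  wave_function U u0 u a b gam Psi -> solves_linear U u (phi1 a b gam Psi).
Proof.
move=> oU Hu hgam [V [hV [Hreg HX]]].
have [ab [hg _]] := hgam; have ab' := Rlt_le _ _ ab.
have [L HL] := regular_hol_lambda_derivative Hreg.
have [cPsi HPsi] := regular_for_Ck1 (proj1 Hreg).
have [F HF] : exists F : coords N -> jpts c (coords N) -> C, forall i P, U P.1 /\ V P.2 ->
    is_jpd (inl i) Psi P (F i P) /\ continuous (F i) P.
  exists (fun i => proj1_sig (constructive_indefinite_description _ (HPsi (inl i)))) => i P HP.
  have [h1 [h2 _]] := proj2_sig (constructive_indefinite_description _ (HPsi (inl i))).
  by split; [exact: h1|exact: h2].
set c0 := (- (RtoC 1 / (RtoC 2 * RtoC PI * Ci)))%C.
pose A t := contour_int a b gam (fun z => Psi (t, z)).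
pose B t := contour_int a b gam (fun z => z * Psi (t, z))%C.
(* For complex t, integration over the contour only hands on continuous first partials; the second
   order comes from analyticity in t, via [regular_Ck]. *)
have CkA : Ck (@is_pd c (coords N)) 2 U A.
  by apply: regular_Ck => //; apply: regular_contour_int hg hV oU (proj1 Hreg).
have CkB : Ck (@is_pd c (coords N)) 2 U B.
  apply: regular_Ck => //.
  apply: (@regular_contour_int c _ a b gam U V (fun P => P.2 * Psi P)%C) => //.
  exact: regular_for_lambda_mult (proj1 Hreg).
have Ck0 f : Ck (@is_pd c (coords N)) 2 U f -> Ck (@is_pd c (coords N)) 2 U (fun t => c0 * f t)%C.
  by move=> Hf; apply: Ck_mult => //; [exact: line_op_pd|apply: Ck_const; exact: line_op_pd].
(* The prefactor [c0] of [phi1] is carried along, so the potential is [c0] times the lambda-moment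
   of [Psi]. *)
apply: (@solves_linear_of_potential c N U u _ (fun t => c0 * B t)%C) => //.
- by move=> p; apply: regular_Ck.
- exact: Ck0.
- exact: Ck0.
move=> k t Ut.
have onD s : a <= s <= b -> U (t, gam s).1 /\ V (t, gam s).2 by move=> hs; split=> //; apply: (proj2 hV).
have dA i : is_pd i A t (contour_int a b gam (fun z => F i (t, z))).
  by apply: (is_pd_contour_int hg hV oU Ut) => P HP; have [h1 h2] := HF i P HP; split=> //; exact: cPsi.
have dB i : is_pd i B t (contour_int a b gam (fun z => z * F i (t, z))%C).
  apply: (@is_pd_contour_int c _ i a b gam U V (fun P => P.2 * Psi P)%C (fun P => P.2 * F i P)%C) => // P HP.
  have [h1 h2] := HF i P HP.
  have c2 : continuous (fun P : jpts c (coords N) => P.2 : C) P.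
    by apply: (@continuous_sndC _ C_UniformSpace (fun z => z)); apply: continuous_Cid.
  split; [by apply: continuous_Cmult => //; exact: cPsi|exact: continuous_Cmult|exact: is_deriv_scal].
have cF i s : a <= s <= b -> continuous (fun z : C_UniformSpace => F i (t, z)) (gam s).
  by move=> /onD HP; apply: continuous_pair_section; case: (HF i _ HP).
have cL s : a <= s <= b -> continuous (fun z : C_UniformSpace => L (t, z)) (gam s).
  by move=> /onD HP; apply: continuous_pair_section; case: (HL _ HP).
rewrite /Dt /phi1 -/c0 (is_pd_pd (is_deriv_scal c0 (dA (dt k)))) (is_pd_pd (is_deriv_scal c0 (dB (dx k)))).
rewrite /Csum (eq_bigr (fun p => c0 * (pd (dx k) (u p) t * contour_int a b gam (fun z => F (dx p) (t, z))))%C); last first.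
  by move=> p _; rewrite (is_pd_pd (is_deriv_scal c0 (dA (dx p)))); ring.
rewrite -big_distrr /= -Cmult_plus_distr_l; congr (c0 * _)%C.
have I0 : contour_int a b gam (fun z => L (t, z)) = RtoC 0.
  apply: (@contour_int_derivative a b gam (fun z => Psi (t, z))) => // s hs.
  by split; [case: (HL _ (onD s hs))|exact: cL].
(* X_k Psi = 0 on the curve, solved for the term with the factor lambda, which is the integrand of
   d_k B. The coefficients from [u] and [u0] are free of lambda and leave the integral below. *)
have HX0 : contour_int a b gam (fun z => (F (dt k) (t, z) + \big[Cplus/RtoC 0]_(p < N) (pd (dx k) (u p) t * F (dx p) (t, z))) + pd (dx k) u0 t * L (t, z))%C
   = contour_int a b gam (fun z => z * F (dx k) (t, z))%C.
  apply: contour_int_eq => // s hs; have HP := onD s hs.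
  have := HX k (t, gam s) HP.1 HP.2.
  rewrite /X /pdt /pdlam /Csum /= (is_C_derive_unique _ _ _ (proj2 (HL _ HP))).
  have E i : pd i (fun t' => Psi (t', gam s)) t = F i (t, gam s).
    by apply: is_pd_pd; exact: (proj1 (HF i _ HP)).
  rewrite !E (eq_bigr (fun p => pd (dx k) (u p) t * F (dx p) (t, gam s))%C); last by move=> p _; rewrite E.
  have e (x y z w : C) : (x + y + z - w = x - w + y + z)%C by ring.
  by move=> H0; apply: Cminus_eq_0; rewrite e.
have cS p s : a <= s <= b -> continuous (fun z : C_UniformSpace => pd (dx k) (u p) t * F (dx p) (t, z))%C (gam s).
  by move=> hs; apply: continuous_Cmult; [exact: continuous_Cconst|exact: cF].
have cSum s : a <= s <= b -> continuous (fun z : C_UniformSpace => \big[Cplus/RtoC 0]_(p < N) (pd (dx k) (u p) t * F (dx p) (t, z)))%C (gam s).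
  by move=> hs; apply: (@continuous_bigsum C_UniformSpace) => p; apply: cS.
rewrite -HX0 contour_int_plus //; first last.
- by move=> s hs; apply: continuous_Cmult; [exact: continuous_Cconst|exact: cL].
- by move=> s hs; apply: continuous_Cplus; [exact: cF|exact: cSum].
rewrite contour_int_plus //; last by move=> s; apply: cF.
rewrite contour_int_scal // I0 contour_int_bigsum //.
rewrite Cmult_0_r Cplus_0_r; congr (_ + _)%C.
by apply: eq_bigr => p _; rewrite contour_int_scal // => s; apply: cF.
Qed.

Lemma open_forall (T : UniformSpace) (I : finType) (P : I -> T -> Prop) :
  (forall i, open (P i)) -> open (fun x => forall i, P i x).
Proof.
move=> H x Px.
have : locally x (fun y => forall i, i \in index_enum I -> P i y).
  elim: (index_enum I) => [|i l IH]; first by apply: filter_forall.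
  apply: filter_imp (filter_and _ _ (H i x (Px i)) IH) => y [h1 h2] j.
  by rewrite in_cons => /orP[/eqP -> //|/h2].
by apply: filter_imp => y Hy i; apply: Hy; rewrite mem_index_enum.
Qed.

(** The algebra of the derivation property: [d] stands for the partials of r, and [x], [y], [w], [l]
    for the t^k_1-derivatives, the x^k-derivatives, the (d_k u^)-terms and the lambda-derivatives of
    the wave functions; [z] is lambda and [v] is d_k u_0. *)
Lemma Csum_linear_combination (M : nat) (d x y w l : 'I_M -> C) (z v : C) :
  (\big[Cplus/RtoC 0]_(i < M) (d i * x i) - z * \big[Cplus/RtoC 0]_(i < M) (d i * y i)
   + \big[Cplus/RtoC 0]_(i < M) (d i * w i) + v * \big[Cplus/RtoC 0]_(i < M) (d i * l i))%C =
  \big[Cplus/RtoC 0]_(i < M) (d i * (x i - z * y i + w i + v * l i))%C.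
Proof.
have -> (A B : C) : (A - z * B = A + (- z) * B)%C by ring.
rewrite !big_distrr /= -!big_split /=.
by apply: eq_bigr => i _; ring.
Qed.

Lemma wave_function_comp c (N M : nat) (U : pts c (coords N) -> Prop)
    (u0 : pts c (coords N) -> C) (u : 'I_N -> pts c (coords N) -> C) (a b : R) (gam : R -> C)
    (Psis : 'I_M -> jpts c (coords N) -> C) (D : pts ComplexVars 'I_M -> Prop)
    (r : pts ComplexVars 'I_M -> C) (V : C -> Prop) :
  (forall i, wave_function U u0 u a b gam (Psis i)) -> open D -> analytic D r ->
  nbhd_of_curve a b gam V ->
  (forall P : jpts c (coords N), U P.1 -> V P.2 -> D (fun i => Psis i P)) ->
  wave_function U u0 u a b gam (fun P => r (fun i => Psis i P)).
Proof.
move=> HPsi oD Hr [oV gV] HD.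
have [W HW] := fin_all_exists HPsi.
(* Every wave function comes with its own neighbourhood of the curve; finitely many are intersected,
   together with the one on which r is applicable. *)
pose V' z := V z /\ forall i, W i z.
have VW i z : V' z -> W i z by case.
have ED (P : jpts c (coords N)) : U P.1 /\ V' P.2 -> D (fun i => Psis i P).
  by move=> [h1 [h2 _]]; apply: HD.
have [dr [Hdr _]] := analytic_partials oD Hr.
have reg i : regular_hol (fun P => U P.1 /\ V' P.2) (Psis i).
  have [_ [[h1 h2] _]] := HW i; split; last by move=> P [Up VP]; apply: h2; split=> //; apply: VW.
  have sub n : Ck (@is_jpd c (coords N)) n (fun P => U P.1 /\ W i P.2) (Psis i) ->
      Ck (@is_jpd c (coords N)) n (fun P => U P.1 /\ V' P.2) (Psis i).
    by apply: Ck_sub => P [Up VP]; split=> //; apply: VW.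
  by case: (c) (U) (Psis) sub h1 => U' Psis' sub h1 => [n|]; apply: sub; exact: h1.
have dlam P i : U P.1 /\ V' P.2 ->
    @is_deriv ComplexVars (fun z => Psis i (P.1, z)) P.2 (pdlam (Psis i) P).
  move=> HP; have [l Hl] := proj2 (reg i) P HP.
  by rewrite /pdlam (is_C_derive_unique _ _ _ Hl).
have dtt P i j : U P.1 /\ V' P.2 ->
    is_pd j (fun t => Psis i (t, P.2)) P.1 (pdt j (Psis i) P).
  move=> HP; have [g [h1 _]] := proj2 (regular_for_Ck1 (proj1 (reg i))) (inl j).
  by have h := h1 P HP; rewrite /pdt (is_pd_pd h).
have ep (P : jpts c (coords N)) : (P.1, P.2) = P by case: P.
have clam P : U P.1 /\ V' P.2 -> @is_deriv ComplexVars (fun z => r (fun i => Psis i (P.1, z))) P.2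
    (\big[Cplus/RtoC 0]_(i < M) (dr i (fun i => Psis i P) * pdlam (Psis i) P)%C).
  move=> HP.
  have := @is_deriv_comp_pts ComplexVars _ D r dr (fun i z => Psis i (P.1, z)) P.2 (fun i => pdlam (Psis i) P) oD.
  by rewrite ep; apply=> // [|i]; [exact: ED|exact: dlam].
have ctt P j : U P.1 /\ V' P.2 -> is_pd j (fun t => r (fun i => Psis i (t, P.2))) P.1
    (\big[Cplus/RtoC 0]_(i < M) (dr i (fun i => Psis i P) * pdt j (Psis i) P)%C).
  move=> HP.
  have := @is_deriv_comp_pts c _ D r dr (fun i s => Psis i (upd P.1 j s, P.2)) (P.1 j) (fun i => pdt j (Psis i) P) oD.
  by rewrite upd_id ep; apply=> // [|i]; [exact: ED|exact: dtt].
exists V'; split; first split.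
- move=> z [h1 h2]; apply: filter_and; first exact: oV.
  by apply: (open_forall (P := W)) => // i; case: (HW i) => -[].
- by move=> s hs; split; [exact: gV|move=> i; case: (HW i) => -[_ h] _; exact: h].
split.
  split; last by move=> P HP; eexists; exact: (clam P HP).
  have K n : (forall i, Ck (@is_jpd c (coords N)) n (fun P => U P.1 /\ V' P.2) (Psis i)) ->
      Ck (@is_jpd c (coords N)) n (fun P => U P.1 /\ V' P.2) (fun P => r (fun i => Psis i P)).
    by apply: (Ck_comp _ oD Hr ED); exact: line_op_jpd.
  have reg' i := proj1 (reg i).
  by case: (c) (U) (Psis) K reg' => U' Psis' K reg' => [n|]; apply: K => i; exact: (reg' i).
move=> k P Up VP; have HP : U P.1 /\ V' P.2 by [].
have E j : pdt j (fun P => r (fun i => Psis i P)) P =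
    \big[Cplus/RtoC 0]_(i < M) (dr i (fun i => Psis i P) * pdt j (Psis i) P)%C.
  exact: is_pd_pd (ctt P j HP).
have El : pdlam (fun P => r (fun i => Psis i P)) P =
    \big[Cplus/RtoC 0]_(i < M) (dr i (fun i => Psis i P) * pdlam (Psis i) P)%C.
  exact: (is_C_derive_unique _ _ _ (clam P HP)).
(* By the chain rule X_k of the composite is this combination, each term of which vanishes. *)
transitivity (\big[Cplus/RtoC 0]_(i < M) (dr i (fun i => Psis i P) * X u0 u k (Psis i) P)%C); last first.
  apply: big1 => i _; have [_ [_ ->]] := HW i => //; [ring|exact: VW].
have ES : Csum (fun p => pd (dx k) (u p) P.1 * pdt (dx p) (fun P => r (fun i => Psis i P)) P)%C =
    \big[Cplus/RtoC 0]_(i < M) (dr i (fun i => Psis i P) *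
       Csum (fun p => pd (dx k) (u p) P.1 * pdt (dx p) (Psis i) P))%C.
  rewrite /Csum.
  rewrite (eq_bigr (fun p => \big[Cplus/RtoC 0]_(i < M)
    (dr i (fun i => Psis i P) * (pd (dx k) (u p) P.1 * pdt (dx p) (Psis i) P))%C)).
    by rewrite exchange_big; apply: eq_bigr => i _; rewrite big_distrr.
  by move=> p _; rewrite E big_distrr; apply: eq_bigr => i _ /=; ring.
rewrite /X El !E ES; exact: Csum_linear_combination.
Qed.

Theorem mainTheorem2 (c : scalars) (N : nat) (hN : (2 <= N)%N)
    (U : pts c (coords N) -> Prop) (hU : open U)
    (u0 : pts c (coords N) -> C) (u : 'I_N -> pts c (coords N) -> C)
    (hu0 : regular U u0) (hu : forall p : 'I_N, regular U (u p))
    (hX : commute_pairwise U u0 u)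
    (a b : R) (gam : R -> C) (hgam : closed_curve a b gam) :
  (forall Psi : jpts c (coords N) -> C,
     wave_function U u0 u a b gam Psi ->
     solves_linear U u (phi1 a b gam Psi)) /\
  (forall (Psis : 'I_N.+1 -> jpts c (coords N) -> C)
          (D : pts ComplexVars 'I_N.+1 -> Prop)
          (r : pts ComplexVars 'I_N.+1 -> C)
          (V : C -> Prop),
     (forall i : 'I_N.+1, wave_function U u0 u a b gam (Psis i)) ->
     open D -> analytic D r ->
     nbhd_of_curve a b gam V ->
     (forall P : jpts c (coords N), U P.1 -> V P.2 -> D (fun i => Psis i P)) ->
     solves_linear U u (phi1 a b gam (fun P => r (fun i => Psis i P)))).
Proof.
have H Psi := @wave_function_solves_linear c N U u0 u a b gam Psi hU hu hgam.
split=> // Psis D r V HPsis oD Hr HV HD.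
by apply: H; apply: wave_function_comp HPsis oD Hr HV HD.
Qed.
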